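(* Suppose $(\mathscr{G},\omega)$ is a Cartan geometry of type $(G,H)$ and $\mathrm{g}$ is an inner product on $\mathfrak{g}$. For each $\mathscr{e}\in\mathscr{G}$, there exists an $r_{\mathscr{e}}>0$ such that every path $\gamma\in\mathrm{Path}_e(G)$ whose length with respect to $\mathrm{g}_{\omega_G}$ is less than $r_{\mathscr{e}}$ has a well-defined antidevelopment $\gamma_{\mathscr{G}}$ starting at $\mathscr{e}$.
   Context: A model $(G,H)$ is a Lie group $G$ with a closed subgroup $H$ such that $G/H$ is connected; $e\in G$ is the identity and $\omega_G$ is the (left-invariant) Maurer--Cartan form. A Cartan geometry of type $(G,H)$ over a smooth manifold $M$ is a principal (right) $H$-bundle $\mathscr{G}\to M$ with a $\mathfrak{g}$-valued one-form $\omega$ such that each $\omega_{\mathscr{g}}\colon T_{\mathscr{g}}\mathscr{G}\to\mathfrak{g}$ is a linear isomorphism, $R_h^*\omega=\mathrm{Ad}_{h^{-1}}\omega$ for $h\in H$, and for $Y\in\mathfrak{h}$ the flow of $\omega^{-1}(Y)$ is $t\mapsto R_{\exp(tY)}$. ''Path'' means piecewise smooth path. $\mathrm{Path}_{\mathscr{e}}(\mathscr{G})$ is the set of paths $[0,1]\to\mathscr{G}$ starting at $\mathscr{e}$, and $\mathrm{Path}_e(G)$ is the set of paths $[0,1]\to G$ starting at $e$. The development of a path $\gamma\colon[0,1]\to\mathscr{G}$ is the unique path $\gamma_G\colon[0,1]\to G$ with $\gamma_G(0)=e$ and $\gamma^*\omega=\gamma_G^*\omega_G$. An antidevelopment of $\gamma\in\mathrm{Path}_e(G)$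 starting at $\mathscr{e}\in\mathscr{G}$ is a path $\gamma_{\mathscr{G}}\in\mathrm{Path}_{\mathscr{e}}(\mathscr{G})$ with $(\gamma_{\mathscr{G}})_G=\gamma$. $\mathrm{g}_{\omega_G}$ is the left-invariant Riemannian metric on $G$ given by $\mathrm{g}_{\omega_G}(\xi_1,\xi_2)=\mathrm{g}(\omega_G(\xi_1),\omega_G(\xi_2))$. *)

(* Defs.v *)
From HB Require Import structures.
From mathcomp Require Import all_boot all_order all_algebra.
From mathcomp Require Import all_classical all_reals all_analysis.

Set Implicit Arguments.
Unset Strict Implicit.
Unset Printing Implicit Defensive.
Import Order.TTheory GRing.Theory Num.Theory.
Import numFieldNormedType.Exports.
Local Open Scope classical_set_scope.
Local Open Scope ring_scope.

Section SmoothEuclidean.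
Context {R : realType} {E F : normedModType R}.

(* For finite-dimensional E, f is C^oo near a iff all its iterated directional
   derivatives exist and are continuous on a neighbourhood of a. *)
Definition iter_derive (vs : seq E) (f : E -> F) : E -> F :=
  foldr (fun v g => 'D_v g) f vs.

Definition cinfty_at (f : E -> F) (a : E) : Prop :=
  \forall x \near a, forall vs : seq E,
    {for x, continuous (iter_derive vs f)} /\
    forall v, derivable (iter_derive vs f) x v.

End SmoothEuclidean.

(* [param] is the inverse of [coord]; both are total functions whose values
   outside [dom] and outside [coord @` dom] are irrelevant. *)
Record chart (E T : Type) := Chart {
  dom : set T;
  coord : T -> E;
  param : E -> T }.

(* An atlas indexed by the points of T, the chart [A p] being a chart around p.
   Any smooth structure has such an atlas, and an atlas determines the smooth
   structure. *)
Definition atlas (E T : Type) := T -> chart E T.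

Definition id_atlas (E : Type) : atlas E E := fun=> Chart setT id id.

Definition prod_atlas (E F S T : Type) (A : atlas E S) (B : atlas F T) :
    atlas (E * F) (S * T) := fun p =>
  Chart (dom (A p.1) `*` dom (B p.2))
        (fun q => (coord (A p.1) q.1, coord (B p.2) q.2))
        (fun x => (param (A p.1) x.1, param (B p.2) x.2)).

Section SmoothMaps.
Context {R : realType} {E F : normedModType R} {S T : topologicalType}.
Variables (A : atlas E S) (B : atlas F T).

Definition local_expr (f : S -> T) (p : S) : E -> F :=
  coord (B (f p)) \o f \o param (A p).

Definition smooth_at (f : S -> T) (p : S) : Prop :=
  {for p, continuous f} /\ cinfty_at (local_expr f p) (coord (A p) p).

(* D is an arbitrary subset, as in the usual definition of smooth maps on
   subsets: f|_D extends locally to a smooth map.  For D = [a, b] in the real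
   line this is smoothness up to the endpoints; for D a closed subgroup of a Lie
   group (hence an embedded submanifold) it is smoothness for the submanifold
   structure of D. *)
Definition smooth_on (D : set S) (f : S -> T) : Prop :=
  forall p, D p -> exists2 g : S -> T,
    smooth_at g p & \forall q \near p, D q -> g q = f q.

(* The tangent space at p is the model space E, a vector being identified with
   its components in the chart [A p]. *)
Definition tangent_map (f : S -> T) (p : S) : E -> F :=
  fun v => 'D_v (local_expr f p) (coord (A p) p).

End SmoothMaps.

Section Manifolds.
Context {R : realType}.

Record is_manifold (n : nat) (T : topologicalType) (A : atlas 'rV[R]_n T) :
    Prop := {
  manifold_hausdorff : hausdorff_space T;
  manifold_second_countable : @second_countable T;
  atlas_cover : forall p, dom (A p) p;
  atlas_open_dom : forall p, open (dom (A p));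
  atlas_open_coord : forall p, open (coord (A p) @` dom (A p));
  atlas_coordK : forall p q, dom (A p) q -> param (A p) (coord (A p) q) = q;
  atlas_coord_continuous : forall p q, dom (A p) q ->
    {for q, continuous (coord (A p))};
  atlas_param_continuous : forall p q, dom (A p) q ->
    {for coord (A p) q, continuous (param (A p))};
  atlas_transition : forall p p' q, dom (A p) q -> dom (A p') q ->
    cinfty_at (coord (A p') \o param (A p)) (coord (A p) q) }.

Record manifold (n : nat) := Manifold {
  mfd_space :> topologicalType;
  mfd_atlas : atlas 'rV[R]_n mfd_space;
  mfd_axioms : is_manifold mfd_atlas }.

(* A smooth one-form on T with values in F, [omega p] being defined on the
   tangent space at p.  The vector [tangent_map _ A (param c) x v] is the one
   whose components in the chart c are v. *)
Definition smooth_form (E F : normedModType R) (T : topologicalType)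
    (A : atlas E T) (omega : T -> E -> F) : Prop :=
  (forall p, linear (omega p)) /\
  forall p q, dom (A p) q -> forall v : E,
    cinfty_at (fun x => omega (param (A p) x)
                 (tangent_map (@id_atlas E) A (param (A p)) x v))
              (coord (A p) q).

Section Curves.
Context {n : nat} {T : topologicalType}.
Variable A : atlas 'rV[R]_n T.

Definition velocity (c : R -> T) (t : R) : 'rV[R]_n :=
  tangent_map (@id_atlas R) A c t 1.

(* Paths [0, 1] -> T are represented by functions on R of which only the
   restriction to [0, 1] is relevant. *)
Definition piecewise_smooth_path (c : R -> T) : Prop :=
  exists2 s : seq R, itv_partition 0 1 s &
    forall i, (i < size s)%N ->
      smooth_on (@id_atlas R) A
        [set` `[nth 0 (0 :: s) i, nth 0 (0 :: s) i.+1]] c.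

Definition path_from (p : T) (c : R -> T) : Prop :=
  piecewise_smooth_path c /\ c 0 = p.

End Curves.
End Manifolds.
Arguments manifold : clear implicits.
Arguments mfd_atlas {R n} m _ : rename.

#[short(type="groupTopologyType")]
HB.structure Definition GroupTopology := {G of Group G & Topological G}.

Record lie_group (R : realType) (n : nat) := LieGroup {
  lie_space :> groupTopologyType;
  lie_atlas : atlas 'rV[R]_n lie_space;
  lie_manifold : is_manifold lie_atlas;
  lie_mul_smooth : forall p : lie_space * lie_space,
    smooth_at (prod_atlas lie_atlas lie_atlas) lie_atlas
      (fun q => (q.1 * q.2)%g) p;
  lie_inv_smooth : forall p : lie_space,
    smooth_at lie_atlas lie_atlas (fun q => q^-1%g) p }.

Arguments lie_atlas {R n} l _ : rename.

(* The Lie algebra of G is its tangent space at the identity, that is, 'rV[R]_n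
   with the chart [lie_atlas G 1]. *)
Section LieGroupTheory.
Context {R : realType} {n : nat} {G : lie_group R n}.
Local Notation AG := (lie_atlas G).
Local Notation g := 'rV[R]_n.

Definition maurer_cartan (x : G) : 'rV[R]_n -> g :=
  tangent_map AG AG (fun y => (x^-1 * y)%g) x.

Definition Ad (h : G) : g -> g :=
  tangent_map AG AG (fun y => (h * y * h^-1)%g) 1%g.

Definition one_parameter_subgroup (Y : g) (c : R -> G) : Prop :=
  [/\ forall t, smooth_at (@id_atlas R) AG c t,
      forall s t, c (s + t) = (c s * c t)%g &
      velocity AG c 0 = Y].

Definition lie_exp (Y : g) : G :=
  xget (fun=> 1%g) [set c : R -> G | one_parameter_subgroup Y c] 1.

(* The Lie algebra of a closed subgroup H. *)
Definition lie_subalgebra (H : set G) : set g :=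
  [set Y | forall t : R, H (lie_exp (t *: Y))].

Definition left_invariant_metric (ip : {dot g for idfun}) (x : G)
    (u v : 'rV[R]_n) : R :=
  ip (maurer_cartan x u) (maurer_cartan x v).

Definition path_length (ip : {dot g for idfun}) (c : R -> G) : \bar R :=
  (\int[lebesgue_measure]_(t in `[0%R, 1%R])
     (Num.sqrt (left_invariant_metric ip (c t) (velocity AG c t)
                                               (velocity AG c t)))%:E)%E.

End LieGroupTheory.

Section Cosets.
Local Open Scope quotient_scope.
Context {G : groupTopologyType} {H : set G}.
Hypothesis groupH : group_closed [in H].

Definition same_lcoset (x y : G) : bool := ((x^-1 * y)%g \in H).

Lemma same_lcoset_equiv : equiv_class_of same_lcoset.
Proof.
have [H1 _] := groupH.
have HV := group_closedV groupH; have HM := group_closedM groupH.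
split=> [x|x y|y x z]; rewrite /same_lcoset.
- by rewrite mulVg.
- by apply/idP/idP => /HV; rewrite !unfold_in /= invgM invgK.
- move=> Hxy Hyz; have := HM _ _ Hxy Hyz.
  by rewrite !unfold_in mulgA -(mulgA x^-1%g) mulgV mulg1.
Qed.

Definition coset_space :=
  quotient_topology {eq_quot EquivRelPack same_lcoset_equiv}.
HB.instance Definition _ := Topological.on coset_space.

End Cosets.

Record model (R : realType) (n : nat) (G : lie_group R n) := Model {
  isotropy : set G;
  isotropy_closed : closed isotropy;
  isotropy_group : group_closed [in isotropy];
  model_connected : connected [set: coset_space isotropy_group] }.

Section CartanGeometry.
Context {R : realType} {n : nat} {G : lie_group R n} (H : model G).
Local Notation AG := (lie_atlas G).
Local Notation g := 'rV[R]_n.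

(* Smoothness of maps from or to H is smoothness as maps from a subset of, or
   into, G; [act p h] is relevant only for h in H.  Over U, [p |-> (pi p, eta p)] is an H-equivariant diffeomorphism
   pi^-1(U) -> U * H with inverse s. *)
Record principal_bundle (m k : nat) (P : manifold R m) (M : manifold R k) := {
  proj : P -> M;
  act : P -> G -> P;
  proj_smooth : forall p, smooth_at (mfd_atlas P) (mfd_atlas M) proj p;
  act_smooth : smooth_on (prod_atlas (mfd_atlas P) AG) (mfd_atlas P)
    ([set: P] `*` isotropy H) (fun q => act q.1 q.2);
  act1 : forall p, act p 1%g = p;
  actM : forall p h k, isotropy H h -> isotropy H k ->
    act p (h * k)%g = act (act p h) k;
  proj_act : forall p h, isotropy H h -> proj (act p h) = proj p;
  local_triviality : forall x : M, exists U : set M,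
    [/\ open U, U x & exists (eta : P -> G) (s : M * G -> P),
      [/\ smooth_on (mfd_atlas P) AG (proj @^-1` U) eta,
          smooth_on (prod_atlas (mfd_atlas M) AG) (mfd_atlas P)
            (U `*` isotropy H) s,
          forall p, U (proj p) -> isotropy H (eta p) /\ s (proj p, eta p) = p,
          forall u h, U u -> isotropy H h ->
            proj (s (u, h)) = u /\ eta (s (u, h)) = h &
          forall p h, U (proj p) -> isotropy H h ->
            eta (act p h) = (eta p * h)%g]] }.

Record cartan_geometry (k : nat) (M : manifold R k) := CartanGeometry {
  total_dim : nat;
  total_space :> manifold R total_dim;
  bundle : principal_bundle total_space M;
  omega : total_space -> 'rV[R]_total_dim -> g;
  omega_smooth : smooth_form (mfd_atlas total_space) omega;
  omega_iso : forall p, bijective (omega p);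
  omega_equivariant : forall h, isotropy H h -> forall p v,
    omega (act bundle p h)
      (tangent_map (mfd_atlas total_space) (mfd_atlas total_space)
        (fun q => act bundle q h) p v)
    = Ad (h^-1)%g (omega p v);
  (* t |-> R_(exp (t Y)) is the flow of the vector field omega^-1(Y) *)
  omega_vertical : forall Y, lie_subalgebra (isotropy H) Y -> forall p t,
    let c := fun t : R => act bundle p (lie_exp (t *: Y)) in
    smooth_at (@id_atlas R) (mfd_atlas total_space) c t /\
    omega (c t) (velocity (mfd_atlas total_space) c t) = Y }.

Section Development.
Context {k : nat} {M : manifold R k}.
Variable C : cartan_geometry M.
Local Notation AC := (mfd_atlas C).

(* gamma^* omega = c^* omega_G where both sides are defined; for piecewise smooth paths this
   concerns all but finitely many t. *)
Definition same_pullback (gamma : R -> C) (c : R -> G) : Prop :=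
  forall t, t \in `]0, 1[ ->
    smooth_at (@id_atlas R) AC gamma t -> smooth_at (@id_atlas R) AG c t ->
    omega (gamma t) (velocity AC gamma t) =
    maurer_cartan (c t) (velocity AG c t).

Definition is_development (gamma : R -> C) (c : R -> G) : Prop :=
  let dev := fun c' => path_from AG 1%g c' /\ same_pullback gamma c' in
  dev c /\ forall c', dev c' -> {in `[0, 1], c' =1 c}.

Definition is_antidevelopment (e : C) (c : R -> G) (gamma : R -> C) : Prop :=
  path_from AC e gamma /\ is_development gamma c.

End Development.
End CartanGeometry.

(* Main.v *)
(* In the chart around e, an antidevelopment of c is a solution x of the ODE
   x' = W(x) xi, where xi = c^* omega_G and W(x) is the inverse of omega read in
   the chart.  The inner product bounds the L^1 norm of xi by a multiple of the
   length of c.  On a small ball around e the matrix W is bounded and Lipschitz,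
   so when the length is small the Picard operator preserves the continuous
   curves [0, 1] -> ball and contracts them on the whole of [0, 1]; no
   continuation in time is needed.  On each piece, solving the ODE for a smooth
   extension of xi beyond the endpoints shows that the solution is smooth up to
   the endpoints.
   Both uniqueness claims are one statement about a manifold with a smooth
   coframe omega: a piecewise smooth curve is determined by its initial point
   and its omega-velocity.  It is applied to C, and to G with the Maurer-Cartan
   form. *)
From HB Require Import structures.
From mathcomp Require Import all_boot all_order all_algebra.
From mathcomp Require Import all_classical all_reals all_analysis.
From mathcomp Require Import measurable_realfun ring lra.
Require Import Defs.

Set Implicit Arguments.
Unset Strict Implicit.
Unset Printing Implicit Defensive.
Import Order.TTheory GRing.Theory Num.Theory.
Import numFieldNormedType.Exports.
Local Open Scope classical_set_scope.
Local Open Scope ring_scope.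

(** * Differential calculus of finitely many variables *)

(** [cinfty_at] speaks of iterated directional derivatives, whereas the chain rule, and with it
    every change of chart, is applied to totally differentiable maps. The calculus therefore runs on
    [smooth], which is built from total differentiability on an open set, and [cinfty_smooth] and
    [cinfty_row] translate between the two notions. Finite dimension enters there, through
    [is_frame]. The curve [xi] is only piecewise smooth, and at a partition point the velocity of
    [c] is a junk value. Hence the Picard theorem asks for integrability in time and asserts the
    differential equation only where its right-hand side is continuous. Uniqueness compares smooth
    one-sided germs: just to the right of every time all curves involved are smooth, so that the
    conditional equation in [same_pullback] becomes available. One of the two uniqueness claims is
    hidden in [is_development], which contains the uniqueness of the development. *)

Lemma continuous_for_sum {R : realType} {T : topologicalType}
    {V : normedModType R} {I : Type} (s : seq I) (F : I -> T -> V) (x : T) :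
  (forall i, {for x, continuous (F i)}) ->
  {for x, continuous (fun y => \sum_(i <- s) F i y)}.
Proof.
move=> cF; elim: s => [|i s IH].
  under [X in {for _, continuous X}]eq_fun do rewrite big_nil.
  exact: cst_continuous.
under [X in {for _, continuous X}]eq_fun do rewrite big_cons.
exact: continuousD (cF i) IH.
Qed.

Section DirectionalDerivatives.
Context {R : realType} {E : normedModType R}.

Lemma derive1P (f : E -> R) x v :
  'D_v f x = 'D_1 (fun s : R => f (s *: v + x)) 0.
Proof.
rewrite /derive; set g1 := fun h => h^-1 *: _; set g2 := fun h => h^-1 *: _.
suff -> : g1 = g2 by [].
by apply/funext => h; rewrite /g1 /g2 /= addr0 scale0r add0r [_%:A]mulr1.
Qed.

Lemma is_derive_line (f : E -> R) x v t :
  derivable f (t *: v + x) v ->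
  is_derive t 1 (fun s : R => f (s *: v + x)) ('D_v f (t *: v + x)).
Proof.
move=> /derivable1P /derivable1_diffP df.
have fE : (fun s : R => f (s *: v + x)) =
  (fun h => f (h *: v + (t *: v + x))) \o (fun s => s - t).
  by apply/funext => s /=; rewrite addrA -scalerDl subrK.
have d2 : differentiable (fun s : R => s - t) t.
  exact: differentiableB.
have d3 : differentiable (fun h : R => f (h *: v + (t *: v + x))) (t - t).
  by rewrite subrr.
split; first by rewrite fE; apply/derivable1_diffP/differentiable_comp.
rewrite fE -derive1E derive1_comp; [|exact/derivable1_diffP|exact/derivable1_diffP].
have -> : derive1 (fun s : R => s - t) t = 1.
  by rewrite derive1E derive_val subr0.
by rewrite mulr1 subrr derive1E -derive1P.
Qed.

Lemma MVT_dir (f : E -> R) x v :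
  (forall t : R, 0 <= t <= 1 -> derivable f (t *: v + x) v) ->
  exists2 t : R, 0 <= t <= 1 & f (v + x) - f x = 'D_v f (t *: v + x).
Proof.
move=> df; pose u (s : R) := f (s *: v + x).
have du (t : R) : 0 <= t <= 1 -> is_derive t 1 u ('D_v f (t *: v + x)).
  by move=> /df; exact: is_derive_line.
have [||t] := @MVT R u (fun t : R => 'D_v f (t *: v + x)) 0 1 ltr01.
- by move=> t /[!in_itv] /= /andP[t0 t1]; apply: du; rewrite !ltW.
- apply: derivable_within_continuous => t; rewrite in_itv /= => t01.
  exact: (@ex_derive _ _ _ _ _ _ _ (du t t01)).
rewrite in_itv /= => /andP[t0 t1] eq.
exists t; first by rewrite !ltW.
by move: eq; rewrite /u subr0 mulr1 scale1r scale0r add0r.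
Qed.

(** Homogeneity in the direction follows from derivability along [v] alone, so it is available
    before total differentiability is known. *)
Lemma is_derive_dirZ (f : E -> R) x v t :
  derivable f x v -> is_derive x (t *: v) f (t * 'D_v f x).
Proof.
move=> dfv.
have := dfv; rewrite -{1}(add0r x) -(scale0r v) => /is_derive_line[] d0 e0.
have df : differentiable (fun s : R => f (s *: v + x)) (0 * t).
  by rewrite mul0r; apply/derivable1_diffP.
have h : (fun s : R => f (s *: (t *: v) + x)) = (fun s : R => f (s *: v + x)) \o (fun s => s * t).
  by apply/funext => s /=; rewrite scalerA.
have d2 : differentiable (fun s : R => s * t) 0.
  exact: differentiableM.
have dd : differentiable (fun s : R => f (s *: (t *: v) + x)) 0.
  by rewrite h; apply: differentiable_comp.
split; first exact/derivable1P/derivable1_diffP.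
rewrite derive1P h -derive1E derive1_comp; [|exact/derivable1_diffP|exact/derivable1_diffP].
have -> : derive1 (fun s : R => s * t) 0 = t.
  by rewrite derive1E deriveMr// derive_id mulr1.
rewrite mul0r derive1E e0 scale0r add0r mulrC//.
Qed.

End DirectionalDerivatives.

Section Frames.
Context {R : realType} {E : normedModType R} {I : finType}.
Variables (e : I -> E) (l : I -> {linear E -> R}).

(** Finite-dimensionality in a form shared by the real line, row vectors and products of row
    spaces. *)
Definition is_frame : Prop :=
  (forall i, continuous (l i)) /\ forall w, w = \sum_i l i w *: e i.

Hypothesis frameE : is_frame.

Let part (s : seq I) (h : E) : E := \sum_(i <- s) l i h *: e i.

Lemma frame_coord_bound i : exists2 C, 0 < C & forall h, `|l i h| <= C * `|h|.
Proof. exact/linear_lipschitz/(frameE.1 i). Qed.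

Lemma frame_sum_bound (s : seq I) :
  exists2 C, 0 < C & forall h, `|\sum_(i <- s) l i h *: e i| <= C * `|h|.
Proof.
elim: s => [|i s [C C0 hC]].
  by exists 1 => // h; rewrite big_nil normr0 mul1r.
have [D D0 hD] := frame_coord_bound i.
exists (D * `|e i| + C); first by rewrite ltr_wpDl// mulr_ge0// ltW.
move=> h; rewrite big_cons mulrDl (le_trans (ler_normD _ _))// lerD//.
by rewrite normrZ mulrAC ler_wpM2r.
Qed.

(** The increment from [a] to [part s h + a] is made one frame direction at a time. On each segment
    the mean value theorem produces a partial derivative at an intermediate point, and its
    continuity at [a] controls the error. *)
Lemma derivable_frame_littleo (f : E -> R) (a : E) :
  (\near a, forall i, derivable f a (e i)) ->
  (forall i, {for a, continuous ('D_(e i) f)}) ->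
  forall (s : seq I) (d : R), 0 < d -> \forall h \near (0 : E),
    `|f (part s h + a) - f a - \sum_(i <- s) l i h * 'D_(e i) f a| <= d * `|h|.
Proof.
move=> df cf; elim=> [|i s IH] d d0.
  apply: nearW => h; rewrite /part !big_nil add0r !subrr normr0.
  by rewrite mulr_ge0// ltW.
have [C C0 hC] := frame_coord_bound i.
have [D D0 hD] := frame_sum_bound s.
have d2 : 0 < d / 2 by rewrite divr_gt0.
(* The tolerance [d / 2 / C] absorbs the factor in [|l i h| <= C * |h|]; the other half of [d] goes
   to the induction hypothesis. *)
have dC : 0 < d / 2 / C by rewrite !divr_gt0.
have := cf i; move=> /cvgrPdist_le /(_ _ dC) cfi.
have /nbhs_normP[r /= r0 hr] : \forall y \near a, derivable f y (e i) /\
    `|'D_(e i) f a - 'D_(e i) f y| <= d / 2 / C.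
  by near=> y; split; [exact: (near df y)|exact: (near cfi y)].
(* [K * |h|] bounds the distance from [a] to every point of the segment on which the mean value
   theorem is used. *)
pose K := D + C * `|e i|.
have K0 : 0 < K by rewrite ltr_wpDr// mulr_ge0// ltW.
near=> h.
have hK : K * `|h| < r.
  rewrite -ltr_pdivlMl// mulrC; near: h; apply: nbhs0_lt; exact: divr_gt0.
have inball (t : R) : 0 <= t <= 1 ->
    `|a - (t *: (l i h *: e i) + (part s h + a))| < r.
  move=> /andP[t0 t1]; apply: le_lt_trans hK.
  rewrite addrA [_ + a]addrC opprD addNKr normrN addrC mulrDl.
  rewrite (le_trans (ler_normD _ _))// lerD; [by []|exact: hD|].
  rewrite normrZ ger0_norm//.
  rewrite (@le_trans _ _ `|l i h *: e i|)//; first by rewrite ler_piMl.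
  by rewrite normrZ mulrAC ler_wpM2r.
have [|t t01 eq] := @MVT_dir _ _ f (part s h + a) (l i h *: e i).
  move=> t /inball /hr[dft _].
  exact: (@ex_derive _ _ _ _ _ _ _ (is_derive_dirZ _ dft)).
have [dft ct] := hr _ (inball t t01).
have [_ de] := is_derive_dirZ (l i h) dft.
rewrite {}de in eq.
rewrite big_cons /part big_cons -/(part s h).
rewrite -[f (_ + _ + a)](subrK (f (part s h + a))) -[l i h *: e i + _ + a]addrA eq.
set y := 'D_(e i) f (_ + _) in ct *.
have -> : l i h * y + f (part s h + a) - f a
    - (l i h * 'D_(e i) f a + \sum_(j <- s) l j h * 'D_(e j) f a) =
  l i h * (y - 'D_(e i) f a) + (f (part s h + a) - f a
     - \sum_(j <- s) l j h * 'D_(e j) f a) by ring.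
rewrite (le_trans (ler_normD _ _))// [d in leRHS]splitr mulrDl lerD//; last first.
  by near: h; exact: IH.
rewrite normrM distrC (@le_trans _ _ (C * `|h| * (d / 2 / C)))//.
  by apply: ler_pM.
by rewrite mulrAC [C * _]mulrC divfK// gt_eqF.
Unshelve. all: by end_near. Qed.

Let total (f : E -> R) (a : E) (h : E) : R := \sum_i l i h * 'D_(e i) f a.

Lemma continuous_partial_differentiable (f : E -> R) (a : E) :
  (\near a, forall i, derivable f a (e i)) ->
  (forall i, {for a, continuous ('D_(e i) f)}) ->
  differentiable f a.
Proof.
move=> df cf.
have lin : linear (total f a).
  move=> k u v; rewrite /total scaler_sumr -big_split; apply: eq_bigr => i _ /=.
  by rewrite linearP /= mulrDl [k *: (_ * _)]/GRing.scale /= mulrA.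
pose dM := GRing.isLinear.Build _ _ _ _ _ lin.
pose dL : {linear E -> R} := HB.pack (total f a) dM.
have dLc : continuous dL.
  move=> x; apply: continuous_for_sum => i; apply: continuousM.
    exact: frameE.1.
  exact: cst_continuous.
have : f \o shift a = cst (f a) + dL +o_ 0 id.
  apply/eqaddoP => d d0; apply: filterS (derivable_frame_littleo df cf (index_enum I) d0).
  move=> h /=; rewrite /part -frameE.2 opprD addrA//.
move=> fE; apply/diff_locallyP.
have dd := diff_unique dLc fE.
split; first by rewrite dd.
by rewrite fE dd.
Qed.

Lemma deriveE_frame (F : normedModType R) (f : E -> F) x v : differentiable f x ->
  'D_v f x = \sum_i l i v *: 'D_(e i) f x.
Proof.
move=> df; rewrite deriveE// {1}(frameE.2 v) linear_sum; apply: eq_bigr => i _.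
by rewrite linearZ deriveE.
Qed.

End Frames.

(** * Functions of class C^k and smooth functions *)

Lemma near_eq_continuous {S T : topologicalType} (f g : S -> T) a : {near a, f =1 g} ->
  {for a, continuous f} -> {for a, continuous g}.
Proof.
move=> fg cf; suff : g @ a --> f a by rewrite (nbhs_singleton fg).
by apply: cvg_trans cf; apply: near_eq_cvg.
Qed.

Section NearEq.
Context {R : realType} {E F : normedModType R}.
Implicit Types f g : E -> F.

Lemma near_eq_diff f g a : {near a, f =1 g} -> differentiable f a ->
  differentiable g a /\ 'd g a = 'd f a :> (E -> F).
Proof.
move=> fg /diff_locallyP[cf /eqaddoP fE].
have gE : g \o shift a = cst (g a) + 'd f a +o_ 0 id.
  apply/eqaddoP => d d0; have fga : \forall h \near (0 : E), f (h + a) = g (h + a).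
    by move: fg; rewrite (near_shift (0 : E)); apply: filterS => h /=; rewrite subr0.
  near=> h; rewrite -[X in `|X| <= _]/(g (h + a) - (g a + 'd f a h)).
  by rewrite -(nbhs_singleton fg) -(near fga h)//; near: h; exact: fE.
have dd := diff_unique cf gE; split; last exact: dd.
by apply/diff_locallyP; split; rewrite dd.
Unshelve. all: by end_near. Qed.

End NearEq.

(** Total differentiability is required at every level, so that the chain rule can be iterated by
    induction on [k]. *)
Fixpoint Ck {R : realType} {E : normedModType R} (k : nat) (U : set E) (f : E -> R) : Prop :=
  if k is k'.+1 then
    (forall x, U x -> differentiable f x) /\ forall v, Ck k' U ('D_v f)
  else forall x, U x -> {for x, continuous f}.

Section Ck.
Context {R : realType} {E : normedModType R}.
Implicit Types (U V : set E) (f g : E -> R).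

Lemma CkS k U f : Ck k.+1 U f -> Ck k U f.
Proof.
elim: k f => [|k IH] f [df Df]; last by split=> // v; exact/IH/Df.
by move=> x /df; exact: differentiable_continuous.
Qed.

Lemma Ck_sub k U V f : V `<=` U -> Ck k U f -> Ck k V f.
Proof.
move=> VU; elim: k f => [|k IH] f /=; first by move=> cf x /VU; exact: cf.
by move=> [df Df]; split=> [x /VU|v]; [exact: df|exact/IH/Df].
Qed.

(** Formulas such as the product rule hold only on [U], while [Ck] recurses on globally defined
    derivatives. Openness of [U] makes equality on [U] pass to those derivatives. *)
Lemma Ck_ext k U f g : open U -> {in U, f =1 g} -> Ck k U f -> Ck k U g.
Proof.
move=> oU; have nU x : U x -> nbhs x U by move=> Ux; exact: open_nbhs_nbhs.
have fgn f' g' x : {in U, f' =1 g'} -> U x -> {near x, f' =1 g'}.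
  by move=> fg Ux; near=> y; apply: fg; rewrite inE; near: y; exact: nU.
elim: k f g => [|k IH] f g fg.
  by move=> cf x Ux; exact: near_eq_continuous (fgn _ _ _ fg Ux) (cf x Ux).
move=> [df Df]; split=> [x Ux|v].
  exact: (near_eq_diff (fgn _ _ _ fg Ux) (df _ Ux)).1.
apply: IH (Df v) => x; rewrite inE => Ux; apply: near_eq_derive; exact: fgn.
Unshelve. all: by end_near. Qed.

Lemma Ck_cst k U (c : R) : Ck k U (cst c).
Proof.
elim: k c => [|k IH] c /=; first by move=> x _; exact: cst_continuous.
split=> [x _|v]; first exact: differentiable_cst.
by rewrite (_ : 'D_v (cst c) = cst 0)//; apply/funext => x; rewrite derive_cst.
Qed.

Lemma CkD k U f g : open U -> Ck k U f -> Ck k U g -> Ck k U (f \+ g).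
Proof.
move=> oU; elim: k f g => [|k IH] f g /=.
  by move=> cf cg x Ux; apply: continuousD; [exact: cf|exact: cg].
move=> [df Df] [dg Dg]; split=> [x Ux|v].
  by apply: differentiableD; [exact: df|exact: dg].
apply: Ck_ext oU _ (IH _ _ (Df v) (Dg v)) => x; rewrite inE => Ux /=.
by rewrite deriveD//; apply: diff_derivable; [exact: df|exact: dg].
Qed.

Lemma CkM k U f g : open U -> Ck k U f -> Ck k U g -> Ck k U (f \* g).
Proof.
move=> oU; elim: k f g => [|k IH] f g.
  by move=> cf cg x Ux; apply: continuousM; [exact: cf|exact: cg].
move=> cf cg; have [df Df] := cf; have [dg Dg] := cg.
split=> [x Ux|v].
  by apply: differentiableM; [exact: df|exact: dg].
apply: Ck_ext oU _ (CkD oU (IH _ _ (CkS cf) (Dg v)) (IH _ _ (CkS cg) (Df v))).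
move=> x; rewrite inE => Ux /=.
by rewrite deriveM//; apply: diff_derivable; [exact: df|exact: dg].
Qed.

Lemma Ck_sum k U (I : Type) (s : seq I) (F : I -> E -> R) : open U ->
  (forall i, Ck k U (F i)) -> Ck k U (fun x => \sum_(i <- s) F i x).
Proof.
move=> oU cF; elim: s => [|i s IH].
  by apply: Ck_ext oU _ (Ck_cst k U 0) => x _; rewrite big_nil.
by apply: Ck_ext oU _ (CkD oU (cF i) IH) => x _; rewrite big_cons.
Qed.

Lemma CkV k U f : open U -> (forall x, U x -> f x != 0) -> Ck k U f ->
  Ck k U (fun x => (f x)^-1).
Proof.
move=> oU f0; elim: k f f0 => [|k IH] f f0.
  by move=> cf x Ux; apply: continuousV; [exact: f0|exact: cf].
move=> cf; have [df Df] := cf; split=> [x Ux|v].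
  by apply: differentiableV; [exact: df|exact: f0].
have cV := IH _ f0 (CkS cf).
apply: Ck_ext oU _ (CkM oU (CkM oU (Ck_cst k U (-1)) (CkM oU cV cV)) (Df v)).
move=> x; rewrite inE => Ux /=.
rewrite deriveV//; [|exact: f0|by apply: diff_derivable; exact: df].
by rewrite mulN1r -expr2 exprVn.
Qed.

Lemma Ck_linear k U (l : {linear E -> R}) : continuous l -> Ck k U l.
Proof.
move=> cl; elim: k => [|k IH]; first by move=> x _; exact: cl.
split=> [x _|v]; first exact: linear_differentiable.
suff -> : 'D_v l = cst (l v) by exact: Ck_cst.
apply/funext => x; rewrite deriveE; last exact: linear_differentiable.
by rewrite diff_lin.
Qed.

End Ck.

Section CkComp.
Context {R : realType} {E F : normedModType R} {I : finType}.
Context {e : I -> F} {l : I -> {linear F -> R}}.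
Hypothesis frF : is_frame e l.

Lemma frame_continuous (f : E -> F) x :
  (forall i, {for x, continuous (l i \o f)}) -> {for x, continuous f}.
Proof.
move=> cf; rewrite (_ : f = fun y => \sum_i l i (f y) *: e i).
  by apply: continuous_for_sum => i; apply: continuousZr_tmp; exact: cf.
by apply/funext => y; rewrite -frF.2.
Qed.

Lemma frame_differentiable (f : E -> F) x :
  (forall i, differentiable (l i \o f) x) -> differentiable f x.
Proof.
move=> df; rewrite (_ : f = fun y => \sum_(i <- index_enum I) l i (f y) *: e i).
  elim: (index_enum I) => [|i s IH].
    by under eq_fun do rewrite big_nil; exact: differentiable_cst.
  under eq_fun do rewrite big_cons; apply: differentiableD => //.
  by apply: differentiableZl; exact: df.
by apply/funext => y; rewrite -frF.2.
Qed.

Lemma derive_linear_comp (f : E -> F) (m : {linear F -> R}) x v :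
  continuous m -> differentiable f x -> 'D_v (m \o f) x = m ('D_v f x).
Proof.
move=> cm df; have dm y : differentiable m y by exact: linear_differentiable.
by rewrite !deriveE//; [rewrite diff_comp//= diff_lin|exact: differentiable_comp].
Qed.

(** By the chain rule ['D_v (g \o f)] is the sum over [i] of ['D_v (l i \o f)] times
    ['D_(e i) g \o f]. The second factor is again a composition, of class C^k by induction once the
    order of [f] has been lowered by one. *)
Lemma Ck_comp k (U : set E) (V : set F) (f : E -> F) (g : F -> R) :
  open U -> open V -> (forall x, U x -> V (f x)) ->
  (forall i, Ck k U (l i \o f)) -> Ck k V g -> Ck k U (g \o f).
Proof.
move=> oU oV UV; elim: k f g UV => [|k IH] f g UV cf cg.
  move=> x Ux; apply: continuous_comp; last exact/cg/UV.
  by apply: frame_continuous => i; exact: cf.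
have df x : U x -> differentiable f x.
  by move=> Ux; apply: frame_differentiable => i; exact: (cf i).1.
have [dg Dg] := cg.
split=> [x Ux|v].
  by apply: differentiable_comp; [exact: df|exact/dg/UV].
have H i : Ck k U (('D_v (l i \o f)) \* ('D_(e i) g \o f)).
  by apply: CkM => //; [exact: (cf i).2|exact: IH _ _ UV (fun j => CkS (cf j)) (Dg _)].
apply: Ck_ext oU _ (Ck_sum (index_enum I) oU H) => x; rewrite inE => Ux.
have dfx := df x Ux; have dgx := dg _ (UV x Ux).
rewrite deriveE; last exact: differentiable_comp.
rewrite diff_comp//= -!deriveE// (deriveE_frame frF)//.
by apply: eq_bigr => i _ /=; rewrite derive_linear_comp//; exact: frF.1.
Qed.

End CkComp.

Section Smooth.
Context {R : realType} {E : normedModType R}.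
Implicit Types f g : E -> R.

(** A single neighbourhood serves all orders, as in [cinfty_at]. *)
Definition smooth f a : Prop :=
  exists U, [/\ open U, U a & forall k, Ck k U f].

Lemma smooth_near f a : smooth f a -> \forall x \near a, smooth f x.
Proof.
move=> [U [oU Ua cf]]; have : nbhs a U by exact: open_nbhs_nbhs.
by apply: filterS => x Ux; exists U.
Qed.

Lemma smooth_differentiable f a : smooth f a -> differentiable f a.
Proof. by move=> [U [oU Ua cf]]; exact: (cf 1%N).1. Qed.

Lemma smooth_continuous f a : smooth f a -> {for a, continuous f}.
Proof. by move=> /smooth_differentiable; exact: differentiable_continuous. Qed.

Lemma smooth_derive f a v : smooth f a -> smooth ('D_v f) a.
Proof. by move=> [U [oU Ua cf]]; exists U; split=> // k; exact: (cf k.+1).2. Qed.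

Lemma smooth_ext f g a : {near a, f =1 g} -> smooth f a -> smooth g a.
Proof.
move=> fg [U [oU Ua cf]]; exists (U `&` [set x | f x = g x]°); split.
- by apply: openI => //; exact: open_interior.
- by split=> //; exact: fg.
move=> k; have cfk : Ck k (U `&` [set x | f x = g x]°) f.
  by apply: Ck_sub (cf k) => x [].
apply: Ck_ext _ _ cfk; first by apply: openI => //; exact: open_interior.
by move=> x; rewrite inE => -[_ /nbhs_singleton].
Qed.

Lemma smooth_cst c a : smooth (cst c) a.
Proof. by exists setT; split=> //; [exact: openT|move=> k; exact: Ck_cst]. Qed.

Lemma smooth_linear (l : {linear E -> R}) a : continuous l -> smooth l a.
Proof.
by move=> cl; exists setT; split=> //; [exact: openT|move=> k; exact: Ck_linear].
Qed.

Lemma smooth2 f g a : smooth f a -> smooth g a ->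
  exists U, [/\ open U, U a, forall k, Ck k U f & forall k, Ck k U g].
Proof.
move=> [U [oU Ua cf]] [V [oV Va cg]]; exists (U `&` V).
by split=> [| |k|k]; [exact: openI| |exact: Ck_sub (cf k)|exact: Ck_sub (cg k)].
Qed.

Lemma smoothD f g a : smooth f a -> smooth g a -> smooth (fun x => f x + g x) a.
Proof.
move=> sf sg; have [U [oU Ua cf cg]] := smooth2 sf sg.
by exists U; split=> // k; exact: CkD.
Qed.

Lemma smoothM f g a : smooth f a -> smooth g a -> smooth (fun x => f x * g x) a.
Proof.
move=> sf sg; have [U [oU Ua cf cg]] := smooth2 sf sg.
by exists U; split=> // k; exact: CkM.
Qed.

Lemma smooth_sum (I : Type) (s : seq I) (F : I -> E -> R) a :
  (forall i, smooth (F i) a) -> smooth (fun x => \sum_(i <- s) F i x) a.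
Proof.
move=> sF; elim: s => [|i s IH].
  by under eq_fun do rewrite big_nil; exact: smooth_cst.
by under eq_fun do rewrite big_cons; exact: smoothD.
Qed.

Lemma smooth_prod (I : Type) (s : seq I) (F : I -> E -> R) a :
  (forall i, smooth (F i) a) -> smooth (fun x => \prod_(i <- s) F i x) a.
Proof.
move=> sF; elim: s => [|i s IH].
  by under eq_fun do rewrite big_nil; exact: smooth_cst.
by under eq_fun do rewrite big_cons; exact: smoothM.
Qed.

Lemma smoothV f a : f a != 0 -> smooth f a -> smooth (fun x => (f x)^-1) a.
Proof.
move=> fa0 sf; have [U [oU Ua cf]] := sf.
have : \forall x \near a, f x != 0.
  have := smooth_continuous sf.
  by move=> /(_ [set y | y != 0]); apply; apply: open_nbhs_nbhs; split => //; exact: open_neq.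
move=> fn0; pose V := U `&` [set x | f x != 0]°.
have oV : open V by apply: openI => //; exact: open_interior.
exists V; split => // k; apply: CkV => //.
  by move=> x [_ /nbhs_singleton].
by apply: Ck_sub (cf k) => x [].
Qed.

Lemma smooth_det n (M : E -> 'M[R]_n) a :
  (forall i j, smooth (fun x => M x i j) a) -> smooth (fun x => \det (M x)) a.
Proof.
move=> sM; rewrite /determinant; apply: smooth_sum => s; apply: smoothM.
  exact: smooth_cst.
by apply: smooth_prod => i.
Qed.

(** Cramer's formula writes the entries of the inverse as quotients of determinants. It describes
    [invmx] only at invertible matrices, hence the condition near [a]. *)
Lemma smooth_invmx n (M : E -> 'M[R]_n) a :
  (\forall x \near a, M x \in unitmx) ->
  (forall i j, smooth (fun x => M x i j) a) ->
  forall i j, smooth (fun x => invmx (M x) i j) a.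
Proof.
move=> uM sM i j.
apply: (@smooth_ext (fun x => (\det (M x))^-1 * (\adj (M x)) i j)).
  by near=> x; rewrite /invmx (near uM x)// [RHS]mxE.
apply: smoothM.
  apply: smoothV; last exact: smooth_det.
  by have := nbhs_singleton uM; rewrite unitmxE unitfE.
under eq_fun do rewrite mxE /cofactor.
apply: smoothM; first exact: smooth_cst.
by apply: smooth_det => k m; under eq_fun do rewrite !mxE; exact: sM.
Unshelve. all: by end_near. Qed.

End Smooth.

Section SmoothComp.
Context {R : realType} {E F : normedModType R} {I : finType}.
Context {e : I -> F} {l : I -> {linear F -> R}}.
Hypothesis frF : is_frame e l.

Lemma smooth_comp_frame (f : E -> F) (g : F -> R) a :
  (forall i, smooth (l i \o f) a) -> smooth g (f a) -> smooth (g \o f) a.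
Proof.
move=> sf [V [oV Vfa cg]].
have cf : {for a, continuous f}.
  by apply: (frame_continuous frF) => i; exact: smooth_continuous.
have [U hU] := choice sf.
pose W := (\bigcap_(i in [set: I]) U i)° `&` (f @^-1` V)°.
have oW : open W by apply: openI; exact: open_interior.
exists W; split=> //.
  split; last by apply: cf; exact: open_nbhs_nbhs.
  have : \forall x \near a, forall i, U i x.
    by apply: filter_forall => i; have [oU Ua _] := hU i; exact: open_nbhs_nbhs.
  by apply: filterS => x Ux i _.
move=> k; apply: (Ck_comp frF oW oV) => // [x [_ /nbhs_singleton //]|i].
have [_ _ /(_ k)] := hU i; apply: Ck_sub => x [/nbhs_singleton + _].
exact.
Qed.

End SmoothComp.

Section Frames.
Context {R : realType}.

Lemma frame_real : is_frame (fun _ : 'I_1 => 1 : R) (fun=> idfun).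
Proof.
split; first by move=> _ x; exact: cvg_id.
by move=> w; rewrite big_ord1 /= [_ *: _]mulr1.
Qed.

Definition rowcoord n (j : 'I_n) (v : 'rV[R]_n) : R := v 0 j.

Lemma rowcoord_linear n (j : 'I_n) : linear (rowcoord j).
Proof. by move=> k u v; rewrite /rowcoord !mxE. Qed.

HB.instance Definition _ n (j : 'I_n) :=
  GRing.isLinear.Build _ _ _ _ (rowcoord j) (rowcoord_linear j).

Lemma frame_row n : is_frame (fun j : 'I_n => delta_mx 0 j : 'rV[R]_n)
  (fun j => rowcoord j : {linear _ -> _}).
Proof.
split; first by move=> j; exact: coord_continuous.
by move=> w; rewrite [LHS]row_sum_delta.
Qed.

Section Prod.
Context {E F : normedModType R} {I J : finType}.
Context {e : I -> E} {l : I -> {linear E -> R}}.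
Context {e' : J -> F} {l' : J -> {linear F -> R}}.

Definition prodcoord (k : I + J) (w : E * F) : R :=
  match k with inl i => l i w.1 | inr j => l' j w.2 end.

Lemma prodcoord_linear k : linear (prodcoord k).
Proof. by case: k => i c u v /=; rewrite linearP. Qed.

HB.instance Definition _ k :=
  GRing.isLinear.Build _ _ _ _ (prodcoord k) (prodcoord_linear k).

Lemma frame_prod : is_frame e l -> is_frame e' l' ->
  is_frame (fun k : I + J => match k with inl i => (e i, 0) | inr j => (0, e' j) end)
    (fun k => prodcoord k : {linear _ -> _}).
Proof.
move=> fr fr'; split.
  case=> i x; apply: continuous_comp.
  - exact: cvg_fst.
  - exact: fr.1.
  - exact: cvg_snd.
  - exact: fr'.1.
have fst_sum (K : finType) (f : K -> E * F) : (\sum_k f k).1 = \sum_k (f k).1.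
  by apply: (big_morph fst).
have snd_sum (K : finType) (f : K -> E * F) : (\sum_k f k).2 = \sum_k (f k).2.
  by apply: (big_morph snd).
move=> [w w']; rewrite big_sumType /= [RHS]surjective_pairing /=.
rewrite !fst_sum !snd_sum; congr pair.
  rewrite [X in _ + X]big1 ?addr0; first exact: fr.2.
  by move=> j _ /=; rewrite scaler0.
rewrite big1 ?add0r; first exact: fr'.2.
by move=> j _ /=; rewrite scaler0.
Qed.

End Prod.
End Frames.

(** * Comparison with iterated directional derivatives *)

Section Cinfty.
Context {R : realType} {E : normedModType R} {I : finType}.
Context {e : I -> E} {l : I -> {linear E -> R}}.
Hypothesis frE : is_frame e l.

Lemma iter_derive_rcons {F : normedModType R} (vs : seq E) v (f : E -> F) :
  iter_derive (rcons vs v) f = iter_derive vs ('D_v f).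
Proof. by rewrite /iter_derive foldr_rcons. Qed.

Lemma cinfty_open {F : normedModType R} (f : E -> F) a : cinfty_at f a ->
  exists U, [/\ open U, U a & forall x, U x -> forall vs,
    {for x, continuous (iter_derive vs f)} /\
    forall v, derivable (iter_derive vs f) x v].
Proof.
move=> cf; exists [set x | forall vs, {for x, continuous (iter_derive vs f)} /\
    forall v, derivable (iter_derive vs f) x v]°.
by split; [exact: open_interior|exact: cf|move=> x /nbhs_singleton].
Qed.

(** Continuity of the partial derivatives upgrades directional to total differentiability. Since
    [foldr] applies the last direction of the list first, both inductions peel directions off the
    right end, which matches the recursion of [Ck]. *)
Lemma cinfty_smooth (f : E -> R) a : cinfty_at f a <-> smooth f a.
Proof.
split=> [/cinfty_open[U [oU Ua fU]]|[U [oU Ua cf]]].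
  exists U; split=> // k; elim: k f fU => [|k IH] f fU.
    by move=> x /fU /(_ [::])[].
  split=> [x Ux|v].
    apply: (continuous_partial_differentiable frE).
      have : nbhs x U by exact: open_nbhs_nbhs.
      by apply: filterS => y /fU /(_ [::])[_ h] i; exact: h.
    by move=> i; have [] := fU x Ux [:: e i].
  by apply: IH => x Ux vs; rewrite -iter_derive_rcons; exact: fU.
have : nbhs a U by exact: open_nbhs_nbhs.
apply: filterS => x Ux vs; elim/last_ind: vs f cf => [|vs v IH] f cf.
  split; first exact: (cf 0%N).
  by move=> v; apply: diff_derivable; exact: (cf 1%N).1.
rewrite iter_derive_rcons; apply: IH => k; exact: (cf k.+1).2.
Qed.

Lemma iter_derive_row n (f : E -> 'rV[R]_n) (U : set E) : open U ->
  (forall x, U x -> forall vs v, derivable (iter_derive vs f) x v) ->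
  forall vs x j, U x -> iter_derive vs (fun y => f y 0 j) x = iter_derive vs f x 0 j.
Proof.
move=> oU df; elim=> [//|v vs IH] x j Ux /=.
rewrite derive_mx ?mxE; last exact: df.
apply: near_eq_derive; have : nbhs x U by exact: open_nbhs_nbhs.
by apply: filterS => y; exact: IH.
Qed.

Lemma cinfty_row n (f : E -> 'rV[R]_n) a :
  cinfty_at f a <-> forall j, smooth (fun x => f x 0 j) a.
Proof.
split=> [/cinfty_open[U [oU Ua fU]] j|sf].
  apply/cinfty_smooth; have : nbhs a U by exact: open_nbhs_nbhs.
  apply: filterS => x Ux vs.
  have fE := iter_derive_row oU (fun x Ux vs => (fU x Ux vs).2).
  have nE : {near x, (fun y => iter_derive vs f y 0 j) =1 iter_derive vs (fun y => f y 0 j)}.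
    have : nbhs x U by exact: open_nbhs_nbhs.
    by apply: filterS => y Uy; rewrite fE.
  split=> [|v].
    apply: near_eq_continuous nE _.
    exact: (continuous_comp (fU x Ux vs).1 (@coord_continuous _ _ _ 0 j _)).
  apply: near_eq_derivable nE _; have [_ /(_ v)] := fU x Ux vs.
  by move=> /derivable_mxP; apply.
have [U [oU Ua fU]] : exists U, [/\ open U, U a & forall x, U x -> forall j vs,
    {for x, continuous (iter_derive vs (fun y => f y 0 j))} /\
    forall v, derivable (iter_derive vs (fun y => f y 0 j)) x v].
  have : \forall x \near a, forall j vs,
      {for x, continuous (iter_derive vs (fun y => f y 0 j))} /\
      forall v, derivable (iter_derive vs (fun y => f y 0 j)) x v.
    by apply: filter_forall => j; have /cinfty_smooth := sf j.
  move=> h; exists [set x | forall j vs,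
      {for x, continuous (iter_derive vs (fun y => f y 0 j))} /\
      forall v, derivable (iter_derive vs (fun y => f y 0 j)) x v]°.
  by split; [exact: open_interior|exact: h|move=> x /nbhs_singleton].
have nU x : U x -> nbhs x U by move=> Ux; exact: open_nbhs_nbhs.
(* Coordinates and derivability go together in this induction: the coordinates of the next
   derivative are known only if the present one is derivable, and its derivability is read off its
   coordinates. *)
have fE vs : forall x, U x -> (forall j, iter_derive vs (fun y => f y 0 j) x = iter_derive vs f x 0 j)
   /\ forall v, derivable (iter_derive vs f) x v.
  have dE vs' : (forall x, U x -> forall j, iter_derive vs' (fun y => f y 0 j) x = iter_derive vs' f x 0 j)
     -> forall x, U x -> forall v, derivable (iter_derive vs' f) x v.
    move=> h x Ux v; apply/derivable_mxP => i j; rewrite ord1.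
    have := (fU x Ux j vs').2 v; apply: near_eq_derivable.
    by move: (nU x Ux); apply: filterS => y Uy; exact: h.
  elim: vs => [|v vs IH] x Ux; first by split=> // v; apply: (dE [::]).
  have h y : U y -> forall j, iter_derive (v :: vs) (fun y => f y 0 j) y = iter_derive (v :: vs) f y 0 j.
    move=> Uy j /=; rewrite derive_mx ?mxE; last exact: (IH y Uy).2.
    apply: near_eq_derive; have : nbhs y U by exact: open_nbhs_nbhs.
    by apply: filterS => z /IH[].
  by split; [exact: h|exact: (dE _ h)].
have : nbhs a U by exact: open_nbhs_nbhs.
apply: filterS => x Ux vs; split; last exact: (fE vs x Ux).2.
apply: (frame_continuous (frame_row n)) => j /=.
have := (fU x Ux j vs).1; apply: near_eq_continuous.
by move: (nU x Ux); apply: filterS => y Uy; exact: (fE vs y Uy).1.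
Qed.

Lemma derive_row n (f : E -> 'rV[R]_n) a v j : differentiable f a ->
  'D_v f a 0 j = 'D_v (fun x => f x 0 j) a.
Proof. by move=> df; rewrite derive_mx ?mxE//; exact: diff_derivable. Qed.

End Cinfty.

Lemma derive_comp {R : realType} {E F G : normedModType R} (f : E -> F) (g : F -> G) a v :
  differentiable f a -> differentiable g (f a) ->
  'D_v (g \o f) a = 'D_('D_v f a) g (f a).
Proof.
move=> df dg; rewrite deriveE; last exact: differentiable_comp.
by rewrite diff_comp//= -deriveE// -deriveE.
Qed.

(** * Ordinary differential equations *)

Section Primitive.
Context {R : realType}.
Notation mu := (@lebesgue_measure R).
Variables (a b t0 : R).
Hypotheses (ab : a < b) (t0ab : t0 \in `[a, b]).

(** This is the oriented integral from [t0] to [t]. The base point may lie inside [[a, b]], so that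
    solutions run to both sides of it. *)
Definition primitive (g : R -> R) (t : R) : R :=
  \int[mu]_(s in `[a, t]) g s - \int[mu]_(s in `[a, t0]) g s.

Local Notation integrable g := (mu.-integrable `[a, b] (EFin \o g)).

Lemma primitive_base g : primitive g t0 = 0.
Proof. by rewrite /primitive subrr. Qed.

Lemma integrable_initial g t : t \in `[a, b] -> integrable g ->
  mu.-integrable `[a, t] (EFin \o g).
Proof.
rewrite in_itv /= => /andP[_ tb]; apply: integrableS => //.
by apply: subset_itvl; rewrite bnd_simp.
Qed.

Lemma primitiveB g1 g2 t : t \in `[a, b] -> integrable g1 -> integrable g2 ->
  primitive g1 t - primitive g2 t = primitive (fun s => g1 s - g2 s) t.
Proof.
move=> tab i1 i2.
by rewrite /primitive !RintegralB//; [ring|exact: integrable_initial..].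
Qed.

Lemma Rintegral_itvB_bound g h s t : s \in `[a, b] -> t \in `[a, b] -> s <= t ->
  integrable g -> integrable h -> (forall x, x \in `[a, b] -> `|g x| <= h x) ->
  `|\int[mu]_(x in `[a, t]) g x - \int[mu]_(x in `[a, s]) g x| <=
  \int[mu]_(x in `[a, b]) h x.
Proof.
move=> sab tab st ig ih gh.
have [/andP[sa sb] /andP[ta tb]] : (a <= s <= b) /\ (a <= t <= b).
  by move: sab tab; rewrite !in_itv.
rewrite Rintegral_itvB; [|exact: integrable_initial|by rewrite bnd_simp..].
have sub : `]s, t] `<=` `[a, b].
  by move=> x; rewrite /= !in_itv /= => /andP[sx xt]; rewrite (le_trans sa (ltW sx)) (le_trans xt).
have igs : mu.-integrable `]s, t] (EFin \o g) by exact: integrableS ig.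
have ihs : mu.-integrable `]s, t] (EFin \o h) by exact: integrableS ih.
apply: le_trans (le_normr_Rintegral _ igs) _ => //.
apply: (@le_trans _ _ (\int[mu]_(x in `]s, t]) h x)).
  by apply: le_Rintegral => //; [exact: integrable_norm|move=> x /sub; exact: gh].
rewrite /Rintegral fine_le//; [exact: integrable_fin_num..|].
apply: ge0_subset_integral => //.
  by case/integrableP : ih.
by move=> x xab; rewrite lee_fin (le_trans _ (gh x xab)).
Qed.

Lemma primitive_bound g h t : t \in `[a, b] -> integrable g -> integrable h ->
  (forall x, x \in `[a, b] -> `|g x| <= h x) ->
  `|primitive g t| <= \int[mu]_(x in `[a, b]) h x.
Proof.
move=> tab ig ih gh; rewrite /primitive.
have [st|/ltW st] := leP t0 t; first exact: Rintegral_itvB_bound.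
by rewrite distrC; apply: Rintegral_itvB_bound.
Qed.

Lemma primitive_continuous g : integrable g ->
  {within `[a, b], continuous (primitive g)}.
Proof.
move=> ig t; rewrite (_ : primitive g = (fun x => parameterized_integral mu a x g) -
  cst (\int[mu]_(s in `[a, t0]) g s))//.
apply: continuousB _; last exact: cst_continuous.
exact: (parameterized_integral_continuous (ltW ab) ig).
Qed.

Lemma is_derive_primitive g t : t \in `]a, b[ -> integrable g ->
  {for t, continuous g} -> is_derive t 1 (primitive g) (g t).
Proof.
rewrite in_itv /= => /andP[at_ tb] ig cg.
have [d1 d2] := continuous_FTC1_closed tb ig at_ cg.
rewrite -[g t]subr0; apply: is_deriveB.
by split=> //; rewrite -derive1E.
Qed.

End Primitive.

Section RowNorm.
Context {R : realType} {n : nat}.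

Lemma row_norm_le (v : 'rV[R]_n) (c : R) : 0 <= c ->
  (forall j, `|v 0 j| <= c) -> `|v| <= c.
Proof.
move=> c0 vc; rewrite /Num.Def.normr/= mx_normrE.
by apply/bigmax_le => //= -[i j] _ /=; rewrite ord1.
Qed.

Lemma coord_norm_le (v : 'rV[R]_n) j : `|v 0 j| <= `|v|.
Proof.
rewrite [leRHS]/Num.Def.normr/= mx_normrE.
exact: (le_bigmax _ (fun ij : 'I_1 * 'I_n => `|v ij.1 ij.2|) (0, j)).
Qed.

End RowNorm.

Lemma cvg_row {R : realType} {T : Type} (Fl : set_system T) {FF : Filter Fl} n
    (F : 'I_n -> T -> R) (l : 'I_n -> R) : (forall j, F j x @[x --> Fl] --> l j) ->
  \row_j F j x @[x --> Fl] --> \row_j l j.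
Proof.
move=> Fcvg; apply/cvgrPdist_le => e e0; near=> x.
apply: row_norm_le; first exact: ltW.
near: x; apply: filter_forall => j; have /cvgrPdist_le /(_ e e0) := Fcvg j.
by apply: filterS => x; rewrite !mxE.
Unshelve. all: by end_near. Qed.

Lemma is_derive_row {R : realType} n (F : R -> 'rV[R]_n) (t : R) (d : 'rV[R]_n) :
  (forall j, is_derive t 1 (fun s => F s 0 j) (d 0 j)) -> is_derive t 1 F d.
Proof.
move=> dF; have dd : derivable F t 1.
  by apply/derivable_mxP => i j; rewrite ord1; have [] := dF j.
split=> //; apply/rowP => j; rewrite derive_mx// mxE.
by have [] := dF j.
Qed.

(** * Picard iteration with an integrable weight in time *)

Section Picard.
Context {R : realType} {m : nat}.
Notation mu := (@lebesgue_measure R).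
Variables (x0 : 'rV[R]_m) (rho K L a b t0 : R) (h : R -> R).
Variable f : R -> 'rV[R]_m -> 'rV[R]_m.
Hypotheses (rho0 : 0 <= rho) (L0 : 0 <= L) (K0 : 0 <= K).
Hypotheses (ab : a < b) (t0ab : t0 \in `[a, b]).
Hypotheses (h0 : forall t, t \in `[a, b] -> 0 <= h t)
  (ih : mu.-integrable `[a, b] (EFin \o h)).
Hypothesis f_bound : forall t y, t \in `[a, b] -> `|y - x0| <= rho ->
  `|f t y| <= K * h t.
Hypothesis f_lipschitz : forall t y z, t \in `[a, b] ->
  `|y - x0| <= rho -> `|z - x0| <= rho -> `|f t y - f t z| <= L * h t * `|y - z|.
Hypothesis f_measurable : forall u : R -> 'rV[R]_m,
  {within `[a, b], continuous u} ->
  (forall t, t \in `[a, b] -> `|u t - x0| <= rho) ->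
  forall j, measurable_fun `[a, b] (fun t => f t (u t) 0 j).

Let I := \int[mu]_(s in `[a, b]) h s.
Hypotheses (KI : K * I <= rho) (LI : L * I < 1).

Definition admissible (u : R -> 'rV[R]_m) : Prop :=
  {within `[a, b], continuous u} /\
  forall t, t \in `[a, b] -> `|u t - x0| <= rho.

Definition picard_map (u : R -> 'rV[R]_m) (t : R) : 'rV[R]_m :=
  x0 + \row_j primitive a t0 (fun s => f s (u s) 0 j) t.

Let I_ge0 : 0 <= I. Proof. exact: Rintegral_ge0. Qed.

Lemma integrableZ_h c : mu.-integrable `[a, b] (EFin \o (fun t => c * h t)).
Proof.
have mD : measurable (`[a, b]%classic : set (measurableTypeR R)) by exact: measurable_itv.
exact: (integrableZl mD c ih).
Qed.

Lemma integrable_field u j : admissible u ->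
  mu.-integrable `[a, b] (EFin \o (fun t => f t (u t) 0 j)).
Proof.
move=> [cu bu]; apply: (le_integrable _ _ _ (integrableZ_h K)) => //.
  by apply/measurable_EFinP; exact: f_measurable.
move=> t tab /=; rewrite lee_fin [leRHS]ger0_norm ?mulr_ge0 ?h0//.
exact: le_trans (coord_norm_le _ _) (f_bound tab (bu t tab)).
Qed.

Lemma picard_map_admissible u : admissible u -> admissible (picard_map u).
Proof.
move=> au; split.
  apply/subspace_continuousP => t tab; apply: (@cvgD _ _ _ _ _ (cst x0)); first exact: cvg_cst.
  apply: cvg_row.
  move=> j; have /subspace_continuousP := primitive_continuous (t0 := t0) ab (integrable_field j au).
  exact.
move=> t tab; rewrite /picard_map addrC addKr.
apply: row_norm_le => // j; rewrite mxE (le_trans _ KI)//.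
rewrite -RintegralZl//; apply: (primitive_bound t0ab tab (integrable_field j au) (integrableZ_h K)).
move=> s sab; exact: le_trans (coord_norm_le _ _) (f_bound sab (au.2 s sab)).
Qed.

(** The Lipschitz constant [L * h s] may be unbounded in [s]; only its integral [L * I] enters, at
    every [t] alike. *)
Lemma picard_map_contract u v c : 0 <= c -> admissible u -> admissible v ->
  (forall t, t \in `[a, b] -> `|u t - v t| <= c) ->
  forall t, t \in `[a, b] -> `|picard_map u t - picard_map v t| <= L * I * c.
Proof.
move=> c0 au av uv t tab; rewrite /picard_map opprD addrACA subrr add0r.
apply: row_norm_le; first by rewrite !mulr_ge0.
move=> j; rewrite !mxE.
rewrite (primitiveB t0ab tab (integrable_field j au) (integrable_field j av)).
rewrite mulrAC -RintegralZl//.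
apply: (primitive_bound t0ab tab).
- have mD : measurable (`[a, b]%classic : set (measurableTypeR R)) by exact: measurable_itv.
  exact: (integrableB mD (integrable_field j au) (integrable_field j av)).
- exact: integrableZ_h.
move=> s sab; rewrite [leRHS]mulrAC.
have := f_lipschitz sab (au.2 s sab) (av.2 s sab).
move=> fl; apply: le_trans (_ : `|f s (u s) - f s (v s)| <= _).
  by have := coord_norm_le (f s (u s) - f s (v s)) j; rewrite !mxE.
apply: le_trans fl _; rewrite ler_wpM2l ?mulr_ge0 ?h0//; exact: uv.
Qed.

Let q := L * I.
Let q0 : 0 <= q. Proof. by rewrite /q mulr_ge0. Qed.

Definition picard_seq (k : nat) : R -> 'rV[R]_m := iter k picard_map (cst x0).

Lemma picard_seq_admissible k : admissible (picard_seq k).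
Proof.
elim: k => [|k IH]; last exact: picard_map_admissible.
split; first by apply: continuous_subspaceT => x; exact: cst_continuous.
by move=> t _; rewrite subrr normr0.
Qed.

(* All iterates stay in the ball, so k applications of the contraction to the
   pair (X_n, X_0) give the Cauchy estimate without summing a series. *)
Lemma picard_seq_cauchy k n t : t \in `[a, b] ->
  `|picard_seq (k + n) t - picard_seq k t| <= q ^+ k * rho.
Proof.
elim: k t => [|k IH] t tab.
  by rewrite expr0 mul1r; exact: (picard_seq_admissible n).2.
rewrite exprS -mulrA; apply: picard_map_contract => //; try exact: picard_seq_admissible.
by rewrite mulr_ge0// exprn_ge0.
Qed.

(** The limit is taken pointwise in the complete space of row vectors; uniformity comes from
    [picard_lim_dist], where [n] tends to infinity in the Cauchy estimate. *)
Definition picard_lim (t : R) : 'rV[R]_m := limn (fun k => picard_seq k t).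

Lemma cvg_qn : q ^+ k * rho @[k --> \oo] --> 0.
Proof.
rewrite -(mul0r rho); apply: cvgM; last exact: cvg_cst.
by apply: cvg_expr; rewrite ger0_norm.
Qed.

Lemma picard_seq_cvg t : t \in `[a, b] ->
  picard_seq k t @[k --> \oo] --> picard_lim t.
Proof.
move=> tab; apply/cauchy_cvgP/cauchy_exP => e e0.
have /cvgrPdist_lt /(_ e e0) [N _ hN] := cvg_qn.
exists (picard_seq N t).
suff : \forall k \near \oo, ball (picard_seq N t) e (picard_seq k t) by [].
near=> k; rewrite -ball_normE /= distrC.
have Nk : (N <= k)%N by near: k; exact: nbhs_infty_ge.
rewrite -(subnKC Nk); apply: le_lt_trans (picard_seq_cauchy _ _ tab) _.
have := hN N (leqnn _); rewrite /= sub0r normrN ger0_norm//.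
by rewrite mulr_ge0// exprn_ge0.
Unshelve. all: by end_near. Qed.

Lemma picard_lim_dist k t : t \in `[a, b] ->
  `|picard_lim t - picard_seq k t| <= q ^+ k * rho.
Proof.
move=> tab.
have cv : `|picard_seq (k + n) t - picard_seq k t| @[n --> \oo] -->
    `|picard_lim t - picard_seq k t|.
  apply: cvg_norm; apply: cvgB; last exact: cvg_cst.
  under eq_fun do rewrite addnC.
  have := picard_seq_cvg tab; rewrite -(cvg_shiftn k); exact.
apply: (cvgr_to_le cv); apply: nearW => n; exact: picard_seq_cauchy.
Qed.

(** Reduces the fixed-point equation to estimates at finite stages, so that no limit is exchanged
    with an integral. *)
Lemma le_geometric0 (x : R) : (forall k, x <= q ^+ k * rho) -> x <= 0.
Proof.
move=> xq; apply: (cvgr_to_ge cvg_qn); exact: nearW.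
Qed.

Lemma picard_lim_admissible : admissible picard_lim.
Proof.
split; last first.
  by move=> t tab; have := picard_lim_dist 0 tab; rewrite expr0 mul1r.
apply/subspace_continuousP => t tab; apply/cvgrPdist_lt => e e0.
have e3 : 0 < e / 3 by rewrite divr_gt0.
have /cvgrPdist_lt /(_ _ e3) [N _ /(_ N (leqnn _)) /=] := cvg_qn.
rewrite sub0r normrN ger0_norm ?mulr_ge0 ?exprn_ge0// => hN.
have [/subspace_continuousP /(_ t tab) /cvgrPdist_lt /(_ _ e3) cX _] := picard_seq_admissible N.
near=> s.
have sab : s \in `[a, b] by near: s; exact: withinT.
have -> : picard_lim t - picard_lim s = (picard_lim t - picard_seq N t) +
   (picard_seq N t - picard_seq N s) - (picard_lim s - picard_seq N s).
  by rewrite opprB !addrA !subrK.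
rewrite (le_lt_trans (ler_normB _ _))// (le_lt_trans (lerD (ler_normD _ _) (lexx _)))//.
have -> : e = e / 3 + e / 3 + e / 3 by field.
apply: ltrD; last by apply: le_lt_trans hN; exact: picard_lim_dist.
apply: ltrD; first by apply: le_lt_trans hN; exact: picard_lim_dist.
by near: s.
Unshelve. all: by end_near. Qed.

Lemma picard_lim_fixed t : t \in `[a, b] -> picard_map picard_lim t = picard_lim t.
Proof.
move=> tab; apply/eqP; rewrite -subr_eq0 -normr_le0.
(* The factor 2 pays for two errors, both at most [q ^+ k * rho]: from [picard_map picard_lim] to
   iterate [k.+1], and from that iterate to the limit. *)
suff : `|picard_map picard_lim t - picard_lim t| / 2 <= 0.
  by rewrite pmulr_lle0 // invr_gt0.
apply: le_geometric0 => k; rewrite ler_pdivrMr// mulr_natr mulr2n.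
rewrite -(subrK (picard_seq k.+1 t) (picard_map _ _)) -addrA.
have cq : 0 <= q ^+ k * rho by rewrite mulr_ge0// exprn_ge0.
rewrite (le_trans (ler_normD _ _))// lerD//.
  apply: le_trans (picard_map_contract cq picard_lim_admissible (picard_seq_admissible k)
     (fun s sab => picard_lim_dist k sab) tab) _.
  by rewrite ler_piMl// ltW.
rewrite distrC (le_trans (picard_lim_dist _ tab))// ler_wpM2r// exprS.
by rewrite ler_piMl// ?exprn_ge0// ltW.
Qed.

Theorem picard : exists x : R -> 'rV[R]_m,
  [/\ {within `[a, b], continuous x}, x t0 = x0,
    forall t, t \in `[a, b] -> `|x t - x0| <= rho &
    forall t, t \in `]a, b[ -> {for t, continuous (fun s => f s (x s))} ->
      is_derive t 1 x (f t (x t))].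
Proof.
have aT := picard_map_admissible picard_lim_admissible.
(* The image of the limit, rather than the limit itself, is the witness: it is a primitive by
   construction, which gives the initial value and the derivative at once. *)
exists (picard_map picard_lim); split; [exact: aT.1| |exact: aT.2|].
  rewrite /picard_map; apply/rowP => j.
  by rewrite !mxE primitive_base addr0.
move=> t tab cf.
have tab' : t \in `[a, b] by apply: subset_itv_oo_cc.
have nE : {near t, (fun s => f s (picard_map picard_lim s)) =1 (fun s => f s (picard_lim s))}.
  have : \forall s \near t, s \in `]a, b[ by apply: near_in_itvoo.
  by apply: filterS => s sab; rewrite picard_lim_fixed//; exact: subset_itv_oo_cc.
rewrite (nbhs_singleton nE); apply: is_derive_row => j.
have cl := near_eq_continuous nE cf.
have d : is_derive t 1 (primitive a t0 (fun s => f s (picard_lim s) 0 j)) (f t (picard_lim t) 0 j).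
  apply: is_derive_primitive tab (integrable_field j picard_lim_admissible) _ => //.
  exact: (continuous_comp cl (@coord_continuous _ _ _ 0 j _)).
rewrite -[X in is_derive _ _ _ X]add0r.
have -> : (fun s => picard_map picard_lim s 0 j) =
    cst (x0 0 j) + primitive a t0 (fun s => f s (picard_lim s) 0 j).
  by apply/funext => s; rewrite /picard_map !mxE.
exact: is_deriveD.
Qed.

End Picard.

(** * Local bounds, uniqueness and smoothness of solutions *)

Lemma near_forall {T : topologicalType} {I : finType} {x : T} {P : I -> T -> Prop} :
  (forall i, \forall y \near x, P i y) -> \forall y \near x, forall i, P i y.
Proof. by move=> h; apply: filter_forall. Qed.

Section LocalBounds.
Context {R : realType} {m : nat}.
Implicit Types x y z : 'rV[R]_m.

Lemma ball_segment x y z (rho t : R) : 0 <= t <= 1 ->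
  `|y - x| <= rho -> `|z - x| <= rho -> `|t *: (y - z) + z - x| <= rho.
Proof.
move=> /andP[t0 t1] yx zx.
have -> : t *: (y - z) + z - x = t *: (y - x) + (1 - t) *: (z - x).
  by rewrite scalerBl scale1r !scalerBr; apply/rowP => j; rewrite !mxE; ring.
rewrite (le_trans (ler_normD _ _))// !normrZ !ger0_norm ?subr_ge0//.
have -> : rho = t * rho + (1 - t) * rho by ring.
by rewrite lerD// ler_wpM2l// subr_ge0.
Qed.

(** The mean value theorem on the segment from [z] to [y] turns local bounds on the partial
    derivatives into a Lipschitz constant. Quantifying over all small [rho] lets later proofs impose
    further smallness conditions. *)
Lemma smooth_local_lipschitz (w : 'rV[R]_m -> R) x : smooth w x ->
  exists2 C, 0 <= C & \forall rho \near (0:R)^'+, forall y z,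
    `|y - x| <= rho -> `|z - x| <= rho ->
    `|w y| <= C /\ `|w y - w z| <= C * `|y - z|.
Proof.
move=> sw; pose D (k : 'I_m) := 'D_(delta_mx 0 k : 'rV[R]_m) w.
have bound (g : 'rV[R]_m -> R) : {for x, continuous g} ->
    \forall y \near x, `|g y| <= `|g x| + 1.
  move=> /cvgrPdist_le /(_ 1 ltr01); apply: filterS => y gxy.
  rewrite -[g y](subrK (g x)) (le_trans (ler_normD _ _))// addrC lerD2l//.
  by rewrite distrC.
have : \forall y \near x, [/\ differentiable w y, `|w y| <= `|w x| + 1 &
    forall k : 'I_m, `|D k y| <= `|D k x| + 1].
  have b1 := bound _ (smooth_continuous sw).
  have b2 : \forall y \near x, forall k : 'I_m, `|D k y| <= `|D k x| + 1.
    apply: (near_forall (P := fun k y => `|D k y| <= `|D k x| + 1)) => k.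
    exact: (bound (D k) (smooth_continuous (smooth_derive _ sw))).
  have b0 : \forall y \near x, differentiable w y.
    by apply: filterS (smooth_near sw) => y; exact: smooth_differentiable.
  near=> y; split; [exact: (near b0 y)|exact: (near b1 y)|exact: (near b2 y)].
move=> /nbhs_normP[d /= d0 hd].
(* One constant does both jobs: the first two terms bound [w] near [x], the sum bounds its partial
   derivatives there. *)
exists (`|w x| + 1 + \sum_k (`|D k x| + 1)).
  by rewrite addr_ge0// sumr_ge0// => k _; rewrite addr_ge0.
have dlt : \forall rho \near (0:R)^'+, rho < d by exact: nbhs_right_lt.
near=> rho => y z yx zx.
have inb u : `|u - x| <= rho -> ball_ Num.Def.normr x d u.
  move=> ux; rewrite /ball_ /= distrC (le_lt_trans ux)//.
have S0 : 0 <= \sum_k (`|D k x| + 1) by rewrite sumr_ge0// => k _; rewrite addr_ge0.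
split.
  have [_ h _] := hd _ (inb _ yx); rewrite (le_trans h)// lerDl//.
have [|t t01 eq] := @MVT_dir _ _ w z (y - z).
  move=> t t01; apply: diff_derivable.
  by have [] := hd _ (inb _ (ball_segment t01 yx zx)).
rewrite subrK in eq; rewrite eq.
have [dw _ Dw] := hd _ (inb _ (ball_segment t01 yx zx)).
rewrite (deriveE_frame (frame_row m))// (le_trans (ler_norm_sum _ _ _))//.
apply: (@le_trans _ _ ((\sum_k (`|D k x| + 1)) * `|y - z|)).
  rewrite mulr_suml; apply: ler_sum => k _.
  by rewrite normrZ mulrC; apply: ler_pM => //; [exact: Dw|exact: coord_norm_le].
by rewrite ler_wpM2r// lerDr addr_ge0.
Unshelve. all: by end_near. Qed.

Lemma smooth_mx_local_bounds n p (W : 'rV[R]_m -> 'M[R]_(n, p)) x :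
  (forall i j, smooth (fun y => W y i j) x) ->
  exists2 C, 0 <= C & \forall rho \near (0:R)^'+, forall y z,
    `|y - x| <= rho -> `|z - x| <= rho ->
    (forall v : 'rV[R]_n, `|v *m W y| <= C * `|v|) /\
    forall v : 'rV[R]_n, `|v *m W y - v *m W z| <= C * `|v| * `|y - z|.
Proof.
move=> sW.
have /choice[C hC] : forall ij : 'I_n * 'I_p, exists C : R, 0 <= C /\
    \forall rho \near (0:R)^'+, forall y z,
    `|y - x| <= rho -> `|z - x| <= rho ->
    `|W y ij.1 ij.2| <= C /\ `|W y ij.1 ij.2 - W z ij.1 ij.2| <= C * `|y - z|.
  by move=> [i j]; have [C C0 h] := smooth_local_lipschitz (sW i j); exists C.
pose S := \sum_ij C ij.
have S0 : 0 <= S by apply: sumr_ge0 => ij _; have [] := hC ij.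
(* In the maximum norm a product [v *m W y] is controlled by the column sums of [W y]. *)
have CS j : \sum_i C (i, j) <= S.
  have -> : S = \sum_i \sum_k C (i, k).
    by rewrite /S pair_bigA; apply: eq_bigr => -[].
  apply: ler_sum => i _.
  by rewrite (bigD1 j)//= lerDl sumr_ge0// => k _; have [] := hC (i, k).
exists S => //.
have h : \forall rho \near (0:R)^'+, forall (ij : 'I_n * 'I_p) y z,
    `|y - x| <= rho -> `|z - x| <= rho ->
    `|W y ij.1 ij.2| <= C ij /\ `|W y ij.1 ij.2 - W z ij.1 ij.2| <= C ij * `|y - z|.
  by apply: filter_forall => ij; have [] := hC ij.
apply: filterS h => rho h y z yx zx; split=> v.
  apply: row_norm_le; first by rewrite mulr_ge0.
  move=> j; rewrite mxE (le_trans (ler_norm_sum _ _ _))//.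
  rewrite (@le_trans _ _ ((\sum_i C (i, j)) * `|v|))//; last by rewrite ler_wpM2r.
  rewrite mulr_suml; apply: ler_sum => i _; rewrite normrM mulrC.
  by apply: ler_pM => //; [exact: (h (i, j) y z yx zx).1|exact: coord_norm_le].
rewrite -mulmxBr; apply: row_norm_le; first by rewrite !mulr_ge0.
move=> j; rewrite mxE (le_trans (ler_norm_sum _ _ _))//.
rewrite (@le_trans _ _ ((\sum_i C (i, j)) * `|v| * `|y - z|))//; last first.
  by rewrite ler_wpM2r// ler_wpM2r.
rewrite !mulr_suml; apply: ler_sum => i _; rewrite normrM mulrC mulrAC.
apply: ler_pM => //; last exact: coord_norm_le.
by rewrite !mxE; exact: (h (i, j) y z yx zx).2.
Qed.

End LocalBounds.

Section Uniqueness.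
Context {R : realType} {n : nat}.

Lemma continuous_coord_within (z : R -> 'rV[R]_n) (A : set R) j :
  {within A, continuous z} -> {within A, continuous (fun t => z t 0 j)}.
Proof.
by move=> cz x; exact: (continuous_comp (cz x) (@coord_continuous _ _ _ 0 j _)).
Qed.

(** A short-interval substitute for Gronwall's inequality. At a point [c] where [|z|] is maximal,
    the mean value theorem between [t0] and [c] gives [|z c| <= C * (b - a) * |z c|], and the factor
    is less than 1. *)
Lemma small_growth_eq0 (z : R -> 'rV[R]_n) (a b t0 C : R) :
  t0 \in `[a, b] -> {within `[a, b], continuous z} -> z t0 = 0 -> 0 <= C ->
  C * (b - a) < 1 ->
  (forall t, t \in `]a, b[ -> derivable z t 1 /\ `|'D_1 z t| <= C * `|z t|) ->
  forall t, t \in `[a, b] -> z t = 0.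
Proof.
move=> t0ab cz z0 C0 Cab dz.
have [/andP[at0 t0b] ab] : a <= t0 <= b /\ a <= b.
  by move: (t0ab); rewrite in_itv /= => /andP[h1 h2]; rewrite h1 h2 (le_trans h1).
have cn : {within `[a, b], continuous (fun t => `|z t|)}.
  by move=> x; exact: (continuous_comp (cz x) (@norm_continuous _ _ _)).
have [c cab cmax] := EVT_max ab cn.
have [ac cb] : a <= c /\ c <= b by move: cab; rewrite in_itv /= => /andP.
(* The estimate is made coordinate by coordinate because the mean value theorem is about real
   functions. It is used in both orders, as [c] may lie on either side of [t0]. *)
have key s t j : a <= s -> s <= t -> t <= b ->
    `|z t 0 j - z s 0 j| <= C * (b - a) * `|z c|.
  move=> as_; rewrite le_eqVlt => /predU1P[-> _|st tb].
    by rewrite subrr normr0 !mulr_ge0// subr_ge0.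
  have sub r : r \in `]s, t[ -> r \in `]a, b[.
    by rewrite !in_itv /= => /andP[sr rt]; rewrite (le_lt_trans as_ sr) (lt_le_trans rt tb).
  have [||r rst ->] := @MVT R (fun t => z t 0 j) (fun t => 'D_1 z t 0 j) s t st.
  - move=> r /sub rab.
    have [d _] := dz r rab; split; first by move/derivable_mxP : d; apply.
    by rewrite derive_mx ?mxE.
  - apply: continuous_subspaceW (continuous_coord_within cz).
    by apply: subset_itv; rewrite bnd_simp.
  have [_ dr] := dz r (sub _ rst).
  have ts : 0 <= t - s by rewrite subr_ge0 ltW.
  rewrite normrM (ger0_norm ts) mulrAC.
  apply: ler_pM => //.
    rewrite (le_trans (coord_norm_le _ _))// (le_trans dr)// ler_wpM2l//.
    by apply: cmax; apply: subset_itv_oo_cc; exact: sub.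
  by rewrite lerB.
have zc : `|z c| <= C * (b - a) * `|z c|.
  apply: row_norm_le; first by rewrite !mulr_ge0// subr_ge0.
  move=> j; have [h|/ltW h] := leP t0 c.
    by have := key t0 c j at0 h cb; rewrite z0 mxE subr0.
  by have := key c t0 j ac h t0b; rewrite z0 mxE sub0r normrN.
have {}zc : `|z c| <= 0.
  have : `|z c| * (1 - C * (b - a)) <= 0.
    by rewrite mulrBr mulr1 subr_le0 [leRHS]mulrC.
  by rewrite pmulr_lle0// subr_gt0.
by move=> t tab; apply/eqP; rewrite -normr_le0 (le_trans _ zc)// cmax.
Qed.

(** The difference of two solutions grows at rate at most [C * M] times its own norm, so it vanishes
    on an interval short compared with [1 / (C * M)]. *)
Lemma ode_unique (W : 'rV[R]_n -> 'M[R]_n) (x y : R -> 'rV[R]_n)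
    (xi : R -> 'rV[R]_n) (c : 'rV[R]_n) (rho C M a b t0 : R) :
  0 <= C -> 0 <= M ->
  (forall u v, `|u - c| <= rho -> `|v - c| <= rho ->
     forall w : 'rV[R]_n, `|w *m W u - w *m W v| <= C * `|w| * `|u - v|) ->
  t0 \in `[a, b] -> C * M * (b - a) < 1 ->
  {within `[a, b], continuous x} -> {within `[a, b], continuous y} ->
  x t0 = y t0 ->
  (forall t, t \in `]a, b[ -> `|x t - c| <= rho /\ `|y t - c| <= rho) ->
  (forall t, t \in `]a, b[ -> [/\ is_derive t 1 x (xi t *m W (x t)),
     is_derive t 1 y (xi t *m W (y t)) & `|xi t| <= M]) ->
  forall t, t \in `[a, b] -> x t = y t.
Proof.
move=> C0 M0 WL t0ab CM cx cy xy0 inb dxy t tab.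
apply/eqP; rewrite -subr_eq0; apply/eqP.
apply: (@small_growth_eq0 (x - y) a b t0 (C * M)) => //.
- apply/subspace_continuousP => s sab; apply: (@cvgB _ _ _ _ _ x y).
    by move/subspace_continuousP : cx; exact.
  by move/subspace_continuousP : cy; exact.
- by rewrite /= fctE xy0 subrr.
- exact: mulr_ge0.
move=> s sab; have [dx dy xiM] := dxy s sab; have [bx by_] := inb s sab.
have d : is_derive s 1 (x - y) (xi s *m W (x s) - xi s *m W (y s)).
  exact: is_deriveB.
split; first by case: d.
case: d => _ ->; rewrite (le_trans (WL _ _ bx by_ _))// ler_wpM2r//.
by rewrite ler_wpM2l.
Qed.

End Uniqueness.

Section ChartODE.
Context {R : realType} {n : nat}.
Notation mu := (@lebesgue_measure R).
Implicit Types (x : R -> 'rV[R]_n) (a b t : R).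

Lemma within_itv_continuous_at (T : topologicalType) (x : R -> T) a b t : t \in `]a, b[ ->
  {within `[a, b], continuous x} -> {for t, continuous x}.
Proof.
move=> tab /subspace_continuousP cx.
have tab' : t \in `[a, b] by exact: subset_itv_oo_cc.
have := cx t tab'; rewrite /continuous_at; apply: cvg_trans.
apply: cvg_app; rewrite /within /=; move=> P; rewrite nbhs_simpl /= => hP.
have nab : \forall s \near t, s \in `]a, b[ by exact: near_in_itvoo.
near=> s; have : `[a, b]%classic s -> P s by near: s.
by apply; apply: subset_itv_oo_cc; near: s.
Unshelve. all: by end_near. Qed.

Lemma continuous_mulmx_row (eta : R -> 'rV[R]_n) (W : R -> 'M[R]_n) t :
  {for t, continuous eta} -> (forall i j, {for t, continuous (fun s => W s i j)}) ->
  {for t, continuous (fun s => eta s *m W s)}.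
Proof.
move=> ce cW; apply: (frame_continuous (frame_row n)) => j.
rewrite (_ : _ \o _ = fun s => \sum_i eta s 0 i * W s i j); last first.
  by apply/funext => s; rewrite /= /rowcoord mxE.
apply: continuous_for_sum => i; apply: continuousM; last exact: cW.
exact: (continuous_comp ce (@coord_continuous _ _ _ 0 i _)).
Qed.

Lemma chart_ode_exists (W : 'rV[R]_n -> 'M[R]_n) (x1 : 'rV[R]_n) (rho C : R)
    (eta : R -> 'rV[R]_n) (a b t0 : R) :
  0 <= rho -> 0 <= C -> a < b -> t0 \in `[a, b] ->
  (forall u v, `|u - x1| <= rho -> `|v - x1| <= rho ->
    (forall w : 'rV[R]_n, `|w *m W u| <= C * `|w|) /\
    forall w : 'rV[R]_n, `|w *m W u - w *m W v| <= C * `|w| * `|u - v|) ->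
  (forall u, `|u - x1| <= rho -> forall i j, {for u, continuous (fun v => W v i j)}) ->
  (forall j, measurable_fun `[a, b] (fun t => eta t 0 j)) ->
  mu.-integrable `[a, b] (EFin \o (fun t => `|eta t|)) ->
  C * (\int[mu]_(s in `[a, b]) `|eta s|) <= rho ->
  C * (\int[mu]_(s in `[a, b]) `|eta s|) < 1 ->
  exists x : R -> 'rV[R]_n,
  [/\ {within `[a, b], continuous x}, x t0 = x1,
    forall t, t \in `[a, b] -> `|x t - x1| <= rho &
    forall t, t \in `]a, b[ -> {for t, continuous eta} ->
      is_derive t 1 x (eta t *m W (x t))].
Proof.
move=> rho0 C0 ab t0ab WC cW me ie CI CI1.
(* With weight [|eta|], the constant [C] serves both as bound and as Lipschitz constant of the
   field. *)
have [||||x [cx x0 bx dx]] := @picard R n x1 rho C C a b t0 (fun t => `|eta t|)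
  (fun t u => eta t *m W u) rho0 C0 C0 ab t0ab _ ie _ _ _ CI CI1 => //.
- by move=> t y tab yx; exact: (WC _ _ yx yx).1.
- move=> t y z tab yx zx; exact: (WC _ _ yx zx).2.
- move=> u cu bu j.
  rewrite (_ : (fun t => _) = fun t => \sum_(i <- index_enum 'I_n) eta t 0 i * W (u t) i j); last first.
    by apply/funext => t; rewrite mxE.
  apply: measurable_sum => i; apply: measurable_funM => //.
  apply: subspace_continuous_measurable_fun => //.
  apply/subspace_continuousP => t tab.
  apply: (@cvg_comp _ _ _ u (fun v => W v i j) _ (nbhs (u t))).
    by move/subspace_continuousP : cu; exact.
  exact: cW (bu t tab) i j.
exists x; split; [exact: cx|exact: x0|exact: bx|move=> t tab ce].
apply: (dx t tab).
have cxt := within_itv_continuous_at tab cx.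
apply: (continuous_mulmx_row (W := W \o x) ce) => i j.
have tab' : t \in `[a, b] by exact: subset_itv_oo_cc.
exact: (continuous_comp cxt (cW _ (bx t tab') i j)).
Qed.

(** If [y] is of class C^k, so is the right-hand side [eta t *m W (y t)], hence [y] is of class
    C^(k+1). The open set [S°] is fixed before the induction, so that it serves all [k]. *)
Lemma ode_bootstrap (W : 'rV[R]_n -> 'M[R]_n) (y eta : R -> 'rV[R]_n) t0 :
  (forall i j, smooth (fun u => W u i j) (y t0)) ->
  (forall j, smooth (fun t => eta t 0 j) t0) ->
  {near t0, forall t : R, is_derive t (1 : R) y (eta t *m W (y t))} ->
  forall j, smooth (fun t => y t 0 j) t0.
Proof.
move=> sW se dy.
have /choice[V hV] : forall ij : 'I_n * 'I_n, exists V, [/\ open V, V (y t0) &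
    forall k, Ck k V (fun u => W u ij.1 ij.2)].
  by move=> [i j]; exact: sW.
have /choice[Ue hUe] := se.
have diffy (t : R) : is_derive t 1 y (eta t *m W (y t)) -> differentiable y t.
  by move=> [d _]; exact/derivable1_diffP.
have cy : {for t0, continuous y}.
  by apply: differentiable_continuous; exact/diffy/(nbhs_singleton dy).
pose S := [set t : R | [/\ is_derive t 1 y (eta t *m W (y t)), forall ij, V ij (y t) &
  forall j, Ue j t]].
have nS : nbhs t0 S.
  have h1 : \forall t \near t0, forall ij, V ij (y t).
    apply: near_forall => ij; apply: cy.
    by have [oV Vy _] := hV ij; exact: open_nbhs_nbhs.
  have h2 : \forall t \near t0, forall j, Ue j t.
    apply: near_forall => j; have [oU Ut _] := hUe j; exact: open_nbhs_nbhs.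
  near=> t; split; [exact: (near dy t)|exact: (near h1 t)|exact: (near h2 t)].
have oU : open S° by exact: open_interior.
have US t : S° t -> S t by exact: nbhs_singleton.
move=> j; exists S°; split=> // k; elim: k j => [|k IH] j.
  move=> t /US[dt _ _]; have ct := differentiable_continuous (diffy t dt).
  exact: (continuous_comp ct (@coord_continuous _ _ _ 0 j _)).
have dj t : S° t -> is_derive t 1 (fun s => y s 0 j) (\sum_i eta t 0 i * W (y t) i j).
  move=> /US[[d e] _ _]; split; first by move/derivable_mxP : d; apply.
  have <- : (eta t *m W (y t)) 0 j = \sum_i eta t 0 i * W (y t) i j by rewrite mxE.
  by rewrite -e derive_mx ?mxE.
split=> [t /dj[d _]|v]; first exact/derivable1_diffP.
have cF i : Ck k S° ((fun t => eta t 0 i) \* ((fun u => W u i j) \o y)).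
  apply: CkM => //.
    by have [_ _ /(_ k)] := hUe i; apply: Ck_sub => t /US[].
  have [oV _ /(_ k) cV] := hV (i, j).
  by apply: (Ck_comp (frame_row n) oU oV _ IH cV) => t /US[].
apply: Ck_ext oU _ (CkM oU (Ck_cst k S° v) (Ck_sum (index_enum 'I_n) oU cF)).
move=> t; rewrite inE => /dj[d e] /=.
have [_] := is_derive_dirZ v d; rewrite [v *: 1]mulr1 => ->.
by rewrite e.
Unshelve. all: by end_near. Qed.

(** Here [t0] is interior to the interval of existence; this provides the curve that later extends a
    solution beyond the end of its piece. *)
Lemma chart_ode_smooth (W : 'rV[R]_n -> 'M[R]_n) (x1 : 'rV[R]_n)
    (eta : R -> 'rV[R]_n) t0 :
  (forall i j, smooth (fun u => W u i j) x1) ->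
  (forall j, smooth (fun t => eta t 0 j) t0) ->
  exists y : R -> 'rV[R]_n, [/\ y t0 = x1,
    forall j, smooth (fun t => y t 0 j) t0 &
    {near t0, forall t : R, is_derive t (1 : R) y (eta t *m W (y t))}].
Proof.
move=> sW se.
suff [y y0 dy] : exists2 y : R -> 'rV[R]_n, y t0 = x1 &
    {near t0, forall t : R, is_derive t (1 : R) y (eta t *m W (y t))}.
  exists y; split=> //; apply: ode_bootstrap se dy => i j.
  by rewrite y0.
have [C C0 hC] := smooth_mx_local_bounds sW.
have : \forall u \near x1, forall ij : 'I_n * 'I_n, smooth (fun v => W v ij.1 ij.2) u.
  apply: (near_forall (P := fun (ij : 'I_n * 'I_n) u => smooth (fun v => W v ij.1 ij.2) u)).
  by move=> [i j]; exact: smooth_near.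
move=> /nbhs_normP[d /= d0 hd].
have [rho [hrho rho0 rhod]] : exists rho, [/\ (forall y z,
    `|y - x1| <= rho -> `|z - x1| <= rho ->
    (forall v : 'rV[R]_n, `|v *m W y| <= C * `|v|) /\
    forall v : 'rV[R]_n, `|v *m W y - v *m W z| <= C * `|v| * `|y - z|),
    0 < rho & rho < d].
  have h2 : \forall rho \near (0:R)^'+, 0 < rho by exact: nbhs_right_gt.
  have h3 : \forall rho \near (0:R)^'+, rho < d by exact: nbhs_right_lt.
  have [rho [[h h'] h'']] := filter_ex (filterI (filterI hC h2) h3).
  by exists rho.
have ce t : (forall j, smooth (fun t => eta t 0 j) t) -> {for t, continuous eta}.
  move=> h; apply: (frame_continuous (frame_row n)) => j.
  exact: (smooth_continuous (h j)).
pose M := `|eta t0| + 1.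
have M0 : 0 <= M by rewrite addr_ge0.
have : \forall t \near t0, {for t, continuous eta} /\ `|eta t| <= M.
  have h1 : \forall t \near t0, forall j, smooth (fun t => eta t 0 j) t.
    by apply: near_forall => j; exact: smooth_near.
  have h2 : \forall t \near t0, `|eta t0 - eta t| <= 1.
    by have := ce t0 se; move/cvgrPdist_le; apply.
  near=> t; split; first by apply: ce; exact: (near h1 t).
  rewrite /M -[eta t](subrK (eta t0)) (le_trans (ler_normD _ _))//.
  by rewrite addrC lerD2l distrC; exact: (near h2 t).
move=> /nbhs_normP[e /= e0 he].
(* On an interval of length [2 * dl] where [|eta| <= M], the integral of [|eta|] is at most
   [2 * M * dl]. The minimum with [rho] keeps the iterates in the ball, the one with 1 makes them
   contract, and the summand 1 keeps the divisor positive. *)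
have [dl [dl0 dle dlC]] : exists dl, [/\ 0 < dl, dl < e & dl * (2 * C * M + 1) < Num.min rho 1].
  have K0 : 0 < 2 * C * M + 1 by rewrite ltr_wpDl// !mulr_ge0.
  have m0 : 0 < Num.min rho 1 by rewrite lt_min rho0 ltr01.
  have h2 : \forall dl \near (0:R)^'+, 0 < dl by exact: nbhs_right_gt.
  have h3 : \forall dl \near (0:R)^'+, dl < e by exact: nbhs_right_lt.
  have h4 : \forall dl \near (0:R)^'+, dl < Num.min rho 1 / (2 * C * M + 1).
    by apply: nbhs_right_lt; rewrite divr_gt0.
  have [dl [[h h'] h'']] := filter_ex (filterI (filterI h2 h3) h4).
  by exists dl; split=> //; rewrite -ltr_pdivlMr.
pose a := t0 - dl; pose b := t0 + dl.
have ab : a < b by rewrite /a /b ltrBlDr -addrA ltrDl addr_gt0.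
have t0ab : t0 \in `[a, b] by rewrite in_itv /= /a /b lerBlDr !lerDl ltW.
have hab t : t \in `[a, b] -> {for t, continuous eta} /\ `|eta t| <= M.
  rewrite in_itv /= => /andP[at_ tb]; apply: he; rewrite /ball_ /=.
  apply: le_lt_trans dle; rewrite ler_distl.
  by move: at_ tb; rewrite /a /b !lerBlDr => -> ->.
have cwe : {within `[a, b], continuous eta}.
  by apply: continuous_in_subspaceT => t; rewrite inE => /hab[].
have cwn : {within `[a, b], continuous (fun t => `|eta t|)}.
  by move=> x; exact: (continuous_comp (cwe x) (@norm_continuous _ _ _)).
have ie : mu.-integrable `[a, b] (EFin \o (fun t => `|eta t|)).
  by apply: continuous_compact_integrable => //; exact: segment_compact.
have IM : \int[mu]_(s in `[a, b]) `|eta s| <= M * (2 * dl).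
  have -> : M * (2 * dl) = \int[mu]_(s in `[a, b]) (cst M s).
    rewrite Rintegral_cst//= lebesgue_measure_itv /= lte_fin ab /=.
    by rewrite /a /b; congr (_ * _); ring.
  apply: le_Rintegral => //; last by move=> t /hab[].
  by apply: continuous_compact_integrable; [exact: segment_compact|move=> x; exact: cst_continuous].
have CI : C * (\int[mu]_(s in `[a, b]) `|eta s|) < Num.min rho 1.
  apply: le_lt_trans dlC; apply: (@le_trans _ _ (C * (M * (2 * dl)))).
    by rewrite ler_wpM2l.
  by rewrite mulrDr mulr1 [leLHS](_ : _ = dl * (2 * C * M)) ?lerDl ?ltW//; ring.
have [||||x [cx x0 bx dx]] := @chart_ode_exists W x1 rho C eta a b t0 (ltW rho0) C0 ab t0ab hrho _ _ ie.
- move=> u ux i j; apply: smooth_continuous; apply: (hd _ _ (i, j)).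
  by rewrite /ball_ /= distrC (le_lt_trans ux).
- move=> j; apply: subspace_continuous_measurable_fun => //.
  exact: continuous_coord_within.
- by move: CI; rewrite lt_min => /andP[/ltW].
- by move: CI; rewrite lt_min => /andP[].
exists x => //.
have nab : \forall t \near t0, t \in `]a, b[.
  by apply: near_in_itvoo; rewrite in_itv /= /a /b ltrBlDr !ltrDl dl0.
near=> t; apply: dx; first exact: (near nab t).
have [] := hab t _ => //; apply: subset_itv_oo_cc; exact: (near nab t).
Unshelve. all: by end_near. Qed.

End ChartODE.

(** * Curves and one-forms on manifolds *)

Lemma smooth_row_comp {R : realType} {E : normedModType R} {m : nat}
    (f : E -> 'rV[R]_m) (g : 'rV[R]_m -> R) a :
  (forall i, smooth (fun x => f x 0 i) a) -> smooth g (f a) ->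
  smooth (fun x => g (f x)) a.
Proof. exact: (smooth_comp_frame (frame_row m)). Qed.

Lemma smooth_row_differentiable {R : realType} {E : normedModType R} {m : nat}
    (f : E -> 'rV[R]_m) a :
  (forall i, smooth (fun x => f x 0 i) a) -> differentiable f a.
Proof.
move=> sf; apply: (frame_differentiable (frame_row m)) => j.
exact: (smooth_differentiable (sf j)).
Qed.

Lemma smooth_row_near {R : realType} {E : normedModType R} {m : nat}
    (f : E -> 'rV[R]_m) a :
  (forall i, smooth (fun x => f x 0 i) a) ->
  \forall b \near a, forall i, smooth (fun x => f x 0 i) b.
Proof. by move=> sf; apply: near_forall => i; exact: smooth_near. Qed.

Section Charts.
Context {R : realType} {n : nat} {T : topologicalType} {A : atlas 'rV[R]_n T}.
Hypothesis hA : is_manifold A.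
Implicit Types (p q : T).

Lemma coord_paramK p x : (coord (A p) @` dom (A p)) x ->
  dom (A p) (param (A p) x) /\ coord (A p) (param (A p) x) = x.
Proof. by move=> [q pq <-]; rewrite (atlas_coordK hA pq). Qed.

Lemma dom_nbhs p q : dom (A p) q -> nbhs q (dom (A p)).
Proof. by move=> pq; apply: open_nbhs_nbhs; split=> //; exact: atlas_open_dom. Qed.

Lemma coord_dom_nbhs p q : dom (A p) q ->
  nbhs (coord (A p) q) (coord (A p) @` dom (A p)).
Proof.
move=> pq; apply: open_nbhs_nbhs; split; first exact: (atlas_open_coord hA).
by exists q.
Qed.

Lemma transition_smooth p p' q : dom (A p) q -> dom (A p') q ->
  forall j, smooth (fun x => coord (A p') (param (A p) x) 0 j) (coord (A p) q).
Proof.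
move=> pq p'q; exact/(cinfty_row (frame_row n))/(atlas_transition hA).
Qed.

Section MapsFromNormed.
Context {E : normedModType R}.
Implicit Types (c : E -> T) (t : E).

Lemma curve_dom_near p c t : {for t, continuous c} -> dom (A p) (c t) ->
  \forall s \near t, dom (A p) (c s).
Proof. by move=> cc pc; apply: cc; exact: dom_nbhs. Qed.

Lemma curve_chart_change p p' c t :
  {for t, continuous c} -> dom (A p) (c t) -> dom (A p') (c t) ->
  {near t, (fun s => coord (A p') (param (A p) (coord (A p) (c s)))) =1
     (fun s => coord (A p') (c s))}.
Proof.
move=> cc pc p'c; apply: filterS (curve_dom_near cc pc) => s pcs.
by rewrite (atlas_coordK hA).
Qed.

Lemma curve_smooth_change p p' c t :
  {for t, continuous c} -> dom (A p) (c t) -> dom (A p') (c t) ->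
  (forall j, smooth (fun s => coord (A p) (c s) 0 j) t) ->
  forall j, smooth (fun s => coord (A p') (c s) 0 j) t.
Proof.
move=> cc pc p'c sc j.
apply: (smooth_ext (f := fun s => coord (A p') (param (A p) (coord (A p) (c s))) 0 j)).
  by apply: filterS (curve_chart_change cc pc p'c) => s ->.
exact: (smooth_row_comp sc (transition_smooth pc p'c j)).
Qed.

Lemma param_curve_near p (y : E -> 'rV[R]_n) t :
  (coord (A p) @` dom (A p)) (y t) -> {for t, continuous y} ->
  {for t, continuous (fun s => param (A p) (y s))} /\
  {near t, y =1 (fun s => coord (A p) (param (A p) (y s)))}.
Proof.
move=> yt cy; have [q pq qy] := yt; split.
  apply: (continuous_comp cy); rewrite -qy; exact: (atlas_param_continuous hA).
have : \forall s \near t, (coord (A p) @` dom (A p)) (y s).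
  by apply: cy; rewrite -qy; exact: coord_dom_nbhs.
by apply: filterS => s /coord_paramK[].
Qed.

End MapsFromNormed.

Implicit Types (c : R -> T) (t : R).

(** The definition of [smooth_at] uses the chart assigned to [c t], which varies with [t].
    Statements near [t] need one fixed chart. *)
Lemma curve_smoothP p c t : {for t, continuous c} -> dom (A p) (c t) ->
  smooth_at (@id_atlas R) A c t <->
  forall j, smooth (fun s => coord (A p) (c s) 0 j) t.
Proof.
move=> cc pc; have cct := atlas_cover hA (c t).
split=> [[_ /(cinfty_row frame_real) sc]|sc].
  exact: (curve_smooth_change cc cct pc sc).
split=> //; apply/(cinfty_row frame_real) => j.
exact: (curve_smooth_change cc pc cct sc).
Qed.

(** Continuity of [c] is given only at [t]. At nearby times it is recovered by applying [param] to
    the smooth coordinates. *)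
Lemma curve_smooth_near c t : smooth_at (@id_atlas R) A c t ->
  \forall s \near t, smooth_at (@id_atlas R) A c s.
Proof.
move=> sm; have cc := sm.1; pose p := c t.
have pc : dom (A p) (c t) by exact: (atlas_cover hA).
have /(curve_smoothP cc pc) sc := sm.
have d1 := curve_dom_near cc pc; have d2 := near_join d1.
have s1 := smooth_row_near sc.
apply: filterS (filterI (filterI d1 d2) s1) => s [[pcs d1s] scs].
suff cs : {for s, continuous c} by apply/(curve_smoothP cs pcs).
have cx : {for s, continuous (fun r => coord (A p) (c r))}.
  exact: differentiable_continuous (smooth_row_differentiable scs).
have := continuous_comp cx (atlas_param_continuous hA pcs).
apply: near_eq_continuous; apply: filterS d1s => r pcr /=.
by rewrite (atlas_coordK hA).
Qed.

Lemma smooth_at_ext c c' t : {near t, c =1 c'} ->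
  smooth_at (@id_atlas R) A c t -> smooth_at (@id_atlas R) A c' t.
Proof.
move=> cc' sm; have ct := nbhs_singleton cc'.
have pc : dom (A (c t)) (c t) by exact: (atlas_cover hA).
have /(curve_smoothP sm.1 pc) sc := sm.
have cc : {for t, continuous c'} by exact: near_eq_continuous cc' sm.1.
have pc' : dom (A (c t)) (c' t) by rewrite -ct.
apply/(curve_smoothP cc pc') => j; apply: smooth_ext (sc j).
by apply: filterS cc' => s ->.
Qed.

Lemma velocity_ext c c' t : {near t, c =1 c'} -> velocity A c t = velocity A c' t.
Proof.
move=> cc'; rewrite /velocity /tangent_map /local_expr /= (nbhs_singleton cc').
by apply: near_eq_derive; apply: filterS cc' => s /= ->.
Qed.

Lemma param_curve_smooth p (y : R -> 'rV[R]_n) t :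
  (coord (A p) @` dom (A p)) (y t) -> (forall j, smooth (fun s => y s 0 j) t) ->
  smooth_at (@id_atlas R) A (fun s => param (A p) (y s)) t.
Proof.
move=> yt sy.
have cy := differentiable_continuous (smooth_row_differentiable sy).
have [cc ne] := param_curve_near yt cy.
have [pc _] := coord_paramK yt.
apply/(curve_smoothP cc pc) => j; apply: smooth_ext (sy j).
by apply: filterS ne => s /= <-.
Qed.

End Charts.

Section Forms.
Context {R : realType} {n k : nat} {T : topologicalType} {A : atlas 'rV[R]_n T}.
Variable omega : T -> 'rV[R]_n -> 'rV[R]_k.
Hypothesis hA : is_manifold A.
Hypothesis hom : smooth_form A omega.
Implicit Types (p q : T) (c : R -> T) (t : R) (x v : 'rV[R]_n).

Definition local_form p x v : 'rV[R]_k :=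
  omega (param (A p) x) (tangent_map (@id_atlas _) A (param (A p)) x v).

(** Components are row vectors, so the form acts by multiplication on the right: [v *m form_mx p x],
    see [local_form_mulmx]. *)
Definition form_mx p x : 'M[R]_(n, k) :=
  \matrix_(i, j) local_form p x (delta_mx 0 i) 0 j.

Lemma transition_differentiable p p' q : dom (A p) q -> dom (A p') q ->
  differentiable (coord (A p') \o param (A p)) (coord (A p) q).
Proof.
by move=> pq p'q; apply: smooth_row_differentiable; exact: transition_smooth.
Qed.

Lemma local_formE p q v : dom (A p) q ->
  local_form p (coord (A p) q) v =
  omega q ('D_v (coord (A q) \o param (A p)) (coord (A p) q)).
Proof. by move=> pq; rewrite /local_form /tangent_map /local_expr /= (atlas_coordK hA pq). Qed.

Lemma local_form_mulmx p q v : dom (A p) q ->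
  local_form p (coord (A p) q) v = v *m form_mx p (coord (A p) q).
Proof.
move=> pq; apply/rowP => j; rewrite mxE.
have dt : differentiable (coord (A q) \o param (A p)) (coord (A p) q).
  by apply: transition_differentiable => //; exact: (atlas_cover hA).
have lo := hom.1 q.
pose lM := GRing.isLinear.Build _ _ _ _ _ lo.
pose oL : {linear 'rV[R]_n -> 'rV[R]_k} := HB.pack (omega q) lM.
rewrite local_formE// deriveE// {1}(row_sum_delta v) linear_sum.
rewrite -[omega q _]/(oL _) linear_sum summxE; apply: eq_bigr => i _.
by rewrite !linearZ /= !mxE local_formE// -deriveE.
Qed.

Lemma form_mx_smooth p q : dom (A p) q ->
  forall i j, smooth (fun x => form_mx p x i j) (coord (A p) q).
Proof.
move=> pq i j; have /(cinfty_row (frame_row n))/(_ j) := hom.2 p q pq (delta_mx 0 i).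
suff -> : (fun x => form_mx p x i j) = fun x => local_form p x (delta_mx 0 i) 0 j by [].
by apply/funext => x; rewrite mxE.
Qed.

(** [velocity] is computed in the chart at [c t], which moves along the curve. The chain rule for
    the transition map replaces it by a fixed chart, where the dependence on [t] can be
    differentiated. *)
Lemma form_velocity p c t : {for t, continuous c} -> dom (A p) (c t) ->
  (forall j, smooth (fun s => coord (A p) (c s) 0 j) t) ->
  omega (c t) (velocity A c t) =
  'D_1 (fun s => coord (A p) (c s)) t *m form_mx p (coord (A p) (c t)).
Proof.
move=> cc pc sc; rewrite -local_form_mulmx// local_formE//; congr (omega _ _).
have cct := atlas_cover hA (c t).
rewrite -(derive_comp (f := fun s => coord (A p) (c s))); last 2 first.
- exact: smooth_row_differentiable.
- exact: transition_differentiable.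
rewrite /velocity /tangent_map /local_expr /=; apply: near_eq_derive.
by apply: filterS (curve_chart_change hA cc pc cct) => s /= ->.
Qed.

Lemma form_along_smooth c t : smooth_at (@id_atlas R) A c t ->
  forall j, smooth (fun s => omega (c s) (velocity A c s) 0 j) t.
Proof.
move=> sm j; have pc : dom (A (c t)) (c t) by exact: (atlas_cover hA).
have cc := sm.1; have /(curve_smoothP hA cc pc) sc := sm.
have ne : {near t, (fun s => ('D_1 (fun s => coord (A (c t)) (c s)) s *m
     form_mx (c t) (coord (A (c t)) (c s))) 0 j) =1
     (fun s => omega (c s) (velocity A c s) 0 j)}.
  have h1 := curve_dom_near hA cc pc.
  have h2 := smooth_row_near sc; have h3 := curve_smooth_near hA sm.
  apply: filterS (filterI (filterI h1 h2) h3) => s [[pcs scs] [cs _]].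
  by rewrite (form_velocity cs pcs scs).
apply: smooth_ext ne _.
rewrite (_ : (fun s => _) = fun s => \sum_i 'D_1 (fun s => coord (A (c t)) (c s)) s 0 i *
   form_mx (c t) (coord (A (c t)) (c s)) i j); last by apply/funext => s; rewrite mxE.
apply: smooth_sum => i; apply: smoothM.
  apply: (smooth_ext (f := 'D_1 (fun s => coord (A (c t)) (c s) 0 i))).
    apply: filterS (smooth_row_near sc) => s scs.
    by rewrite derive_row//; exact: smooth_row_differentiable.
  exact: smooth_derive.
exact: (smooth_row_comp sc (form_mx_smooth pc i j)).
Qed.

End Forms.

(** * Piecewise smooth paths and their one-sided germs *)

Section PiecewisePaths.
Context {R : realType} {n : nat} {T : topologicalType} {A : atlas 'rV[R]_n T}.
Hypothesis hA : is_manifold A.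
Implicit Types (c : R -> T) (t : R).

(** The pieces are closed on the left only, so a partition point selects the piece on its right;
    [path_find_left] makes the opposite choice. *)
Lemma path_find_right (a : R) (s : seq R) t : path <%R a s -> a <= t -> t < last a s ->
  exists2 i, (i < size s)%N & nth 0 (a :: s) i <= t < nth 0 (a :: s) i.+1.
Proof.
elim: s a => [|x s IH] a /=; first by move=> _ h1 h2; have := le_lt_trans h1 h2; rewrite ltxx.
move=> /andP[ax xs] at_ tl; have [tx|xt] := ltP t x.
  by exists 0%N => //=; rewrite at_ tx.
by have [i si hi] := IH x xs xt tl; exists i.+1.
Qed.

Lemma path_find_left (a : R) (s : seq R) t : path <%R a s -> a < t -> t <= last a s ->
  exists2 i, (i < size s)%N & nth 0 (a :: s) i < t <= nth 0 (a :: s) i.+1.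
Proof.
elim: s a => [|x s IH] a /=; first by move=> _ h1 h2; have := lt_le_trans h1 h2; rewrite ltxx.
move=> /andP[ax xs] at_ tl; have [tx|xt] := leP t x.
  by exists 0%N => //=; rewrite at_ tx.
by have [i si hi] := IH x xs xt tl; exists i.+1.
Qed.

Lemma piecewise_right_germ c t : piecewise_smooth_path A c -> 0 <= t < 1 ->
  exists2 g, smooth_at (@id_atlas R) A g t /\ g t = c t &
    \forall s \near t^'+, g s = c s.
Proof.
move=> [s [ps /eqP ls] sm] /andP[t0 t1].
have [i si /andP[it ti]] := path_find_right ps t0 (eq_ind_r (fun x => t < x) t1 ls).
have Dt : [set` `[nth 0 (0 :: s) i, nth 0 (0 :: s) i.+1]] t.
  by rewrite /= in_itv /= it ltW.
have [g sg gc] := sm i si t Dt.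
exists g; first by split=> //; exact: (nbhs_singleton gc).
have h1 : \forall r \near t^'+, t < r by exact: nbhs_right_gt.
have h2 : \forall r \near t^'+, r < nth 0 (0 :: s) i.+1 by exact: nbhs_right_lt.
have h3 : \forall r \near t^'+, [set` `[nth 0 (0 :: s) i, nth 0 (0 :: s) i.+1]] r -> g r = c r.
  exact: cvg_within gc.
apply: filterS (filterI (filterI h1 h2) h3) => r [[tr rt] h]; apply: h.
by rewrite /= in_itv /= (le_trans it (ltW tr)) ltW.
Qed.

Lemma piecewise_left_germ c t : piecewise_smooth_path A c -> 0 < t <= 1 ->
  exists2 g, smooth_at (@id_atlas R) A g t /\ g t = c t &
    \forall s \near t^'-, g s = c s.
Proof.
move=> [s [ps /eqP ls] sm] /andP[t0 t1].
have [i si /andP[it ti]] := path_find_left ps t0 (eq_ind_r (fun x => t <= x) t1 ls).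
have Dt : [set` `[nth 0 (0 :: s) i, nth 0 (0 :: s) i.+1]] t.
  by rewrite /= in_itv /= ltW.
have [g sg gc] := sm i si t Dt.
exists g; first by split=> //; exact: (nbhs_singleton gc).
have h1 : \forall r \near t^'-, r < t by exact: nbhs_left_lt.
have h2 : \forall r \near t^'-, nth 0 (0 :: s) i < r by exact: nbhs_left_gt.
have h3 : \forall r \near t^'-, [set` `[nth 0 (0 :: s) i, nth 0 (0 :: s) i.+1]] r -> g r = c r.
  exact: cvg_within gc.
apply: filterS (filterI (filterI h1 h2) h3) => r [[rt tr] h]; apply: h.
by rewrite /= in_itv /= (ltW tr) (le_trans (ltW rt)).
Qed.

(** Equality at the points to the right of [t] becomes equality on a full neighbourhood of each of
    them, which is what velocities depend on. *)
Lemma right_germ_near (g c : R -> T) t : (\forall s \near t^'+, g s = c s) ->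
  \forall s \near t^'+, {near s, g =1 c}.
Proof.
move=> gc; have [d /= d0 hd] : exists2 d : R, 0 < d & forall s, t < s < t + d -> g s = c s.
  move: gc => /nbhs_ballP[d /= d0 hd]; exists d => // s /andP[ts sd].
  apply: hd => //; rewrite /ball /= distrC ger0_norm; last by rewrite subr_ge0 ltW.
  by rewrite ltrBlDl.
have h1 : \forall s \near t^'+, t < s by exact: nbhs_right_gt.
have h2 : \forall s \near t^'+, s < t + d by apply: nbhs_right_lt; rewrite ltrDl.
apply: filterS (filterI h1 h2) => s [ts sd].
have : s \in `]t, t + d[ by rewrite in_itv /= ts.
by move=> /near_in_itvoo; apply: filterS => r; rewrite in_itv /=; exact: hd.
Qed.

Lemma piecewise_right_smooth c t : piecewise_smooth_path A c -> 0 <= t < 1 ->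
  \forall s \near t^'+, smooth_at (@id_atlas R) A c s.
Proof.
move=> pc t01; have [g [sg _] gc] := piecewise_right_germ pc t01.
have h1 := right_germ_near gc.
have h2 : \forall s \near t^'+, smooth_at (@id_atlas R) A g s.
  exact: cvg_within (curve_smooth_near hA sg).
apply: filterS (filterI h1 h2) => s [gcs sgs]; exact: (smooth_at_ext hA gcs sgs).
Qed.

End PiecewisePaths.

Arguments form_mx {R n k T} A omega p x.

(** * Curves on a manifold with a coframe *)

Section Parallelism.
Context {R : realType} {n : nat} {T : topologicalType} {A : atlas 'rV[R]_n T}.
Variable omega : T -> 'rV[R]_n -> 'rV[R]_n.
Hypothesis hA : is_manifold A.
Hypothesis hom : smooth_form A omega.
Hypothesis omega_inj : forall p v, omega p v = 0 -> v = 0.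
Implicit Types (p q : T) (c : R -> T) (t : R) (x v : 'rV[R]_n).

(** The two transition maps compose to the identity near the point; the chain rule then exhibits a
    left inverse of the derivative. *)
Lemma transition_injective p p' q v : dom (A p) q -> dom (A p') q ->
  'D_v (coord (A p') \o param (A p)) (coord (A p) q) = 0 -> v = 0.
Proof.
move=> pq p'q dv0.
have d1 := transition_differentiable hA pq p'q.
have d2 := transition_differentiable hA p'q pq.
have E : coord (A p') q = (coord (A p') \o param (A p)) (coord (A p) q).
  by rewrite /= (atlas_coordK hA pq).
rewrite E in d2.
have := derive_comp v d1 d2; rewrite dv0 derive0 => <-.
rewrite -[LHS](derive_id (coord (A p) q) v); apply: near_eq_derive.
have cp : {for coord (A p) q, continuous (param (A p))}.
  exact: (atlas_param_continuous hA).
have h1 : \forall x \near coord (A p) q, dom (A p') (param (A p) x).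
  by apply: cp; rewrite (atlas_coordK hA pq); exact: dom_nbhs.
apply: filterS (filterI h1 (coord_dom_nbhs hA pq)) => x [p'x /(coord_paramK hA)[px xE]] /=.
by rewrite (atlas_coordK hA p'x) xE.
Qed.

Lemma form_mx_unit p q : dom (A p) q -> form_mx A omega p (coord (A p) q) \in unitmx.
Proof.
move=> pq; rewrite -row_free_unit; apply: inj_row_free => v.
rewrite -(local_form_mulmx hA hom)// (local_formE omega hA)// => /omega_inj.
by apply: transition_injective => //; exact: (atlas_cover hA).
Qed.

(** Over the chart, row [i] holds the components of the vector that [omega] sends to the [i]th basis
    vector; this is the field matrix [W] of the differential equation. *)
Definition frame_mx p x : 'M[R]_n := invmx (form_mx A omega p x).

Lemma frame_mx_smooth p q : dom (A p) q ->
  forall i j, smooth (fun x => frame_mx p x i j) (coord (A p) q).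
Proof.
move=> pq; apply: smooth_invmx; last exact: form_mx_smooth.
apply: filterS (coord_dom_nbhs hA pq) => x [q' pq' <-]; exact: form_mx_unit.
Qed.

Lemma form_velocityK p c t : {for t, continuous c} -> dom (A p) (c t) ->
  (forall j, smooth (fun s => coord (A p) (c s) 0 j) t) ->
  is_derive t 1 (fun s => coord (A p) (c s))
    (omega (c t) (velocity A c t) *m frame_mx p (coord (A p) (c t))).
Proof.
move=> cc pc sc; rewrite (form_velocity hA hom cc pc sc) mulmxK ?form_mx_unit//.
by apply: derivableP; apply: diff_derivable; exact: smooth_row_differentiable.
Qed.

(** In the chart at the common point both curves solve the same equation to the right of [t], driven
    by the [omega]-velocity of [g1]. That velocity is continuous at [t] since [g1] is smooth there,
    which bounds it by [M] nearby. *)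
Lemma germs_agree (g1 g2 : R -> T) t :
  smooth_at (@id_atlas R) A g1 t -> smooth_at (@id_atlas R) A g2 t -> g1 t = g2 t ->
  (\forall s \near t^'+, omega (g1 s) (velocity A g1 s) = omega (g2 s) (velocity A g2 s)) ->
  \forall d \near (0:R)^'+, {in `[t, t + d], g1 =1 g2}.
Proof.
move=> s1 s2 g12 om12; pose p := g1 t.
have c1 := s1.1; have c2 := s2.1.
have p1 : dom (A p) (g1 t) by exact: (atlas_cover hA).
have p2 : dom (A p) (g2 t) by rewrite -g12.
have /(curve_smoothP hA c1 p1) x1s := s1.
have /(curve_smoothP hA c2 p2) x2s := s2.
have sW := frame_mx_smooth p1.
have [C C0 hC] := smooth_mx_local_bounds sW.
have [rho [hrho rho0]] : exists rho, (forall y z,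
    `|y - coord (A p) (g1 t)| <= rho -> `|z - coord (A p) (g1 t)| <= rho ->
    (forall v, `|v *m frame_mx p y| <= C * `|v|) /\
    forall v, `|v *m frame_mx p y - v *m frame_mx p z| <= C * `|v| * `|y - z|) /\ 0 < rho.
  have h2 : \forall rho \near (0:R)^'+, 0 < rho by exact: nbhs_right_gt.
  by have [rho [h h']] := filter_ex (filterI hC h2); exists rho.
pose eta s := omega (g1 s) (velocity A g1 s).
pose M := `|eta t| + 1.
have near_good (g : R -> T) : smooth_at (@id_atlas R) A g t -> g t = p ->
  \forall s \near t, [/\ {for s, continuous g}, dom (A p) (g s),
     forall j, smooth (fun r => coord (A p) (g r) 0 j) s &
     `|coord (A p) (g s) - coord (A p) p| <= rho].
  move=> sg gt; have pg : dom (A p) (g t) by rewrite gt.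
  have /(curve_smoothP hA sg.1 pg) xs := sg.
  have h1 := curve_smooth_near hA sg.
  have h2 := curve_dom_near hA sg.1 pg.
  have h3 : \forall s \near t, `|coord (A p) (g t) - coord (A p) (g s)| <= rho.
    have := differentiable_continuous (smooth_row_differentiable xs).
    by move/cvgrPdist_le; apply.
  apply: filterS (filterI (filterI h1 h2) (filterI h3 (smooth_row_near xs))).
  move=> s [[[cg _] dg] [xg sg']]; split=> //.
  by rewrite distrC; move: xg; rewrite gt.
have etaM : \forall s \near t, `|eta s| <= M.
  have ce : {for t, continuous eta}.
    apply: differentiable_continuous; apply: smooth_row_differentiable.
    exact: (form_along_smooth hA hom).
  have : \forall s \near t, `|eta t - eta s| <= 1 by move/cvgrPdist_le : ce; apply.
  apply: filterS => s h; rewrite /M -[eta s](subrK (eta t)) (le_trans (ler_normD _ _))//.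
  by rewrite addrC lerD2l distrC.
pose good (g : R -> T) s := [/\ {for s, continuous g}, dom (A p) (g s),
     forall j, smooth (fun r => coord (A p) (g r) 0 j) s &
     `|coord (A p) (g s) - coord (A p) p| <= rho].
have /nbhs_ballP[d /= d0 hd] : \forall s \near t,
    (good g1 s /\ good g2 s) /\ `|eta s| <= M.
  exact: filterI (filterI (near_good g1 s1 erefl) (near_good g2 s2 (esym g12))) etaM.
have [e e0 he] : exists2 e : R, 0 < e & forall s, t < s < t + e ->
   omega (g1 s) (velocity A g1 s) = omega (g2 s) (velocity A g2 s).
  move: om12 => /nbhs_ballP[e /= e0 he]; exists e => // s /andP[ts sd].
  apply: he => //; rewrite /ball /= distrC ger0_norm; last by rewrite subr_ge0 ltW.
  by rewrite ltrBlDl.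
have M0 : 0 <= M by rewrite addr_ge0.
have K0 : 0 < C * M + 1 by rewrite ltr_wpDl// mulr_ge0.
have h1 : \forall r \near (0:R)^'+, 0 < r by exact: nbhs_right_gt.
have h2 : \forall r \near (0:R)^'+, r < d by exact: nbhs_right_lt.
have h3 : \forall r \near (0:R)^'+, r < e by exact: nbhs_right_lt.
(* This smallness gives [C * M * r < 1], the condition of [ode_unique] on an interval of length
   [r]. *)
have h4 : \forall r \near (0:R)^'+, r < (C * M + 1)^-1.
  by apply: nbhs_right_lt; rewrite invr_gt0.
apply: filterS (filterI (filterI h1 h2) (filterI h3 h4)) => r [[r0 rd] [re rC]].
have hr s : s \in `[t, t + r] -> ball t d s.
  rewrite in_itv /= => /andP[ts sr]; rewrite /ball /= distrC ger0_norm ?subr_ge0//.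
  by rewrite ltrBlDl (le_lt_trans sr)// ltrD2l.
have cx (g : R -> T) : (forall s, s \in `[t, t + r] ->
    forall j, smooth (fun r => coord (A p) (g r) 0 j) s) ->
    {within `[t, t + r], continuous (fun s => coord (A p) (g s))}.
  move=> h; apply: continuous_in_subspaceT => s; rewrite inE => sI.
  exact: differentiable_continuous (smooth_row_differentiable (h s sI)).
suff xE : forall s, s \in `[t, t + r] -> coord (A p) (g1 s) = coord (A p) (g2 s).
  move=> s sI; have [[[_ d1 _ _] [_ d2 _ _]] _] := hd s (hr s sI).
  by rewrite -(atlas_coordK hA d1) (xE s sI) (atlas_coordK hA d2).
apply: (@ode_unique R n (frame_mx p) (fun s => coord (A p) (g1 s))
  (fun s => coord (A p) (g2 s)) eta (coord (A p) p) rho C M t (t + r) t C0 M0).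
- by move=> u v uc vc; exact: (hrho u v uc vc).2.
- by rewrite in_itv /= lexx lerDl ltW.
- rewrite addrAC subrr add0r.
  apply: (@le_lt_trans _ _ ((C * M + 1) * r)); first by rewrite ler_wpM2r ?ltW// ltrDl.
  by rewrite mulrC -ltr_pdivlMr// mul1r.
- by apply: cx => s /hr /hd[[[]]].
- by apply: cx => s /hr /hd[[_ []]].
- by rewrite g12.
- by move=> s /subset_itv_oo_cc /hr /hd[[[_ _ _ h] [_ _ _ h']] _].
move=> s sI; have sI' := subset_itv_oo_cc sI.
have [[[cg1 d1 sg1 _] [cg2 d2 sg2 _]] eM] := hd s (hr s sI').
split=> //; first exact: form_velocityK.
rewrite /eta he; first exact: form_velocityK.
move: sI; rewrite in_itv /= => /andP[-> sr] /=.
by rewrite (lt_trans sr)// ltrD2l.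
Qed.

End Parallelism.

Section PathsUnique.
Context {R : realType} {n : nat} {T : topologicalType} {A : atlas 'rV[R]_n T}.
Variable omega : T -> 'rV[R]_n -> 'rV[R]_n.
Hypothesis hA : is_manifold A.
Hypothesis hom : smooth_form A omega.
Hypothesis omega_inj : forall p v, omega p v = 0 -> v = 0.

(** Limits from the left are unique in a Hausdorff space, and each path equals a germ continuous at
    [t]. *)
Lemma paths_agree_left (c1 c2 : R -> T) (t : R) :
  piecewise_smooth_path A c1 -> piecewise_smooth_path A c2 -> 0 < t <= 1 ->
  (forall s, 0 <= s < t -> c1 s = c2 s) -> c1 t = c2 t.
Proof.
move=> p1 p2 t01 h; have /andP[t0 t1] := t01.
have [g1 [s1 <-] e1] := piecewise_left_germ p1 t01.
have [g2 [s2 <-] e2] := piecewise_left_germ p2 t01.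
apply: (manifold_hausdorff hA) => U V U1 V2.
have h1 : \forall s \near t^'-, U (g1 s) by apply: cvg_within; exact: s1.1.
have h2 : \forall s \near t^'-, V (g2 s) by apply: cvg_within; exact: s2.1.
have h3 : \forall s \near t^'-, 0 < s by exact: nbhs_left_gt.
have h4 : \forall s \near t^'-, s < t by exact: nbhs_left_lt.
have [s [[Us Vs] [[s0 st] [es1 es2]]]] :=
  filter_ex (filterI (filterI h1 h2) (filterI (filterI h3 h4) (filterI e1 e2))).
exists (g1 s); split=> //; rewrite es1 h ?st ?ltW// -es2//.
Qed.

Lemma paths_agree_right (c1 c2 : R -> T) (t : R) :
  piecewise_smooth_path A c1 -> piecewise_smooth_path A c2 -> 0 <= t < 1 ->
  (\forall s \near t^'+, omega (c1 s) (velocity A c1 s) = omega (c2 s) (velocity A c2 s)) ->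
  c1 t = c2 t ->
  exists2 d : R, 0 < d & t + d <= 1 /\ forall s, t <= s <= t + d -> c1 s = c2 s.
Proof.
move=> p1 p2 t01 om12 c12; have /andP[t0 t1] := t01.
have [g1 [s1 g1t] e1] := piecewise_right_germ p1 t01.
have [g2 [s2 g2t] e2] := piecewise_right_germ p2 t01.
have gt : g1 t = g2 t by rewrite g1t g2t.
have ge : \forall s \near t^'+, omega (g1 s) (velocity A g1 s) = omega (g2 s) (velocity A g2 s).
  have h1 := right_germ_near e1; have h2 := right_germ_near e2.
  apply: filterS (filterI om12 (filterI h1 h2)) => s [+ [n1 n2]].
  rewrite (velocity_ext n1) (velocity_ext n2).
  by rewrite (nbhs_singleton n1) (nbhs_singleton n2).
have h1 := germs_agree hA hom omega_inj s1 s2 gt ge.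
have [e e0 he] : exists2 e : R, 0 < e & forall s, t < s < t + e -> g1 s = c1 s /\ g2 s = c2 s.
  have : \forall s \near t^'+, g1 s = c1 s /\ g2 s = c2 s by exact: filterI e1 e2.
  move=> /nbhs_ballP[e /= e0 he]; exists e => // s /andP[ts sd].
  apply: he => //; rewrite /ball /= distrC ger0_norm; last by rewrite subr_ge0 ltW.
  by rewrite ltrBlDl.
have h2 : \forall r \near (0:R)^'+, 0 < r by exact: nbhs_right_gt.
have h3 : \forall r \near (0:R)^'+, r < e by exact: nbhs_right_lt.
have h4 : \forall r \near (0:R)^'+, r < 1 - t by apply: nbhs_right_lt; rewrite subr_gt0.
have [d [[hd d0] [de dt]]] := filter_ex (filterI (filterI h1 h2) (filterI h3 h4)).
exists d => //; split; first by rewrite addrC -lerBrDr ltW.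
move=> s /andP[]; rewrite le_eqVlt => /predU1P[<- _ //|ts sd].
have [] := he s; first by rewrite ts (le_lt_trans sd)// ltrD2l.
by move=> <- <-; apply: hd; rewrite in_itv /= sd ltW.
Qed.

(** Let [t] be the supremum of the times up to which the paths agree. Agreement passes to [t] by
    [paths_agree_left], and [paths_agree_right] would carry it past [t] if [t < 1]. *)
Theorem paths_unique (c1 c2 : R -> T) :
  piecewise_smooth_path A c1 -> piecewise_smooth_path A c2 -> c1 0 = c2 0 ->
  (forall t : R, 0 <= t < 1 -> \forall s \near t^'+,
     omega (c1 s) (velocity A c1 s) = omega (c2 s) (velocity A c2 s)) ->
  {in `[0, 1], c1 =1 c2}.
Proof.
move=> p1 p2 c0 om12.
pose S := [set t : R | 0 <= t <= 1 /\ forall s, 0 <= s <= t -> c1 s = c2 s].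
have S0 : S 0.
  split; first by rewrite lexx ler01.
  by move=> s /andP[s0 s0']; have -> : s = 0 by apply/le_anti; rewrite s0 s0'.
have ubS : ubound S 1 by move=> t [/andP[]].
have hS : has_sup S by split; [exists 0|exists 1].
pose t := sup S.
have t0 : 0 <= t by apply: ub_le_sup => //; exists 1.
have t1 : t <= 1 by apply: ge_sup => //; exists 0.
have below s : 0 <= s < t -> c1 s = c2 s.
  move=> /andP[s0 st].
  have ts0 : 0 < t - s by rewrite subr_gt0.
  have [r [_ hr] sr] := sup_adherent ts0 hS.
  apply: hr; rewrite s0 ltW//; move: sr; rewrite -/t; lra.
have ct : c1 t = c2 t.
  move: t0; rewrite le_eqVlt => /predU1P[<- //|t0].
  by apply: paths_agree_left => //; rewrite t0.
have St : S t.
  split; first by rewrite t0.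
  move=> s /andP[s0]; rewrite le_eqVlt => /predU1P[-> //|st].
  by apply: below; rewrite s0.
suff tE : t = 1 by move=> s; rewrite in_itv /= -tE => /St.2.
apply/eqP; rewrite eq_le t1 leNgt; apply/negP => tlt1.
have t01 : 0 <= t < 1 by rewrite t0.
have [d d0 [td1 hd]] := paths_agree_right p1 p2 t01 (om12 t t01) ct.
have : S (t + d).
  split; first by rewrite td1 addr_ge0// ltW.
  move=> s /andP[s0 sd]; have [st|/ltW ts] := leP s t; first by apply: St.2; rewrite s0.
  by apply: hd; rewrite ts.
move=> /(ub_le_sup (ex_intro _ 1 ubS)); rewrite -/t; lra.
Qed.

End PathsUnique.

(** * The Maurer-Cartan form *)

Section RowPairs.
Context {R : realType} {m n : nat}.
Local Notation V := 'rV[R]_m.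
Local Notation W := 'rV[R]_n.

Definition frame_rows := frame_prod (@frame_row R m) (@frame_row R n).

Lemma smooth_pair_comp {E : normedModType R} (f1 : E -> V) (f2 : E -> W)
    (g : V * W -> R) a :
  (forall j, smooth (fun x => f1 x 0 j) a) -> (forall j, smooth (fun x => f2 x 0 j) a) ->
  smooth g (f1 a, f2 a) -> smooth (fun x => g (f1 x, f2 x)) a.
Proof.
move=> s1 s2; apply: (smooth_comp_frame frame_rows (f := fun x => (f1 x, f2 x))).
by case=> i; [exact: s1|exact: s2].
Qed.

Lemma smooth_fst_row (w : V * W) j : smooth (fun u : V * W => u.1 0 j) w.
Proof. exact: (smooth_linear w (frame_rows.1 (inl j))). Qed.

Lemma smooth_snd_row (w : V * W) j : smooth (fun u : V * W => u.2 0 j) w.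
Proof. exact: (smooth_linear w (frame_rows.1 (inr j))). Qed.

End RowPairs.

Section LieMaps.
Context {R : realType} {n : nat} {G : lie_group R n}.
Local Notation AG := (lie_atlas G).
Local Notation hG := (lie_manifold G).
Context {E : normedModType R}.
Implicit Types (g : E -> G) (a : E).

(** The source is a normed space without an atlas, so that the same rules for products and inverses
    apply to functions of one chart variable and of a pair. *)
Definition smooth_into g a : Prop :=
  {for a, continuous g} /\ forall j, smooth (fun x => coord (AG (g a)) (g x) 0 j) a.

Lemma smooth_into_chart g a p : smooth_into g a -> dom (AG p) (g a) ->
  forall j, smooth (fun x => coord (AG p) (g x) 0 j) a.
Proof.
move=> [cg sg] pg; exact: (curve_smooth_change hG cg (atlas_cover hG _) pg sg).
Qed.

Lemma smooth_into_cst (x : G) a : smooth_into (fun=> x) a.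
Proof. by split; [exact: cst_continuous|move=> j; exact: smooth_cst]. Qed.

Lemma smooth_into_param p (y : E -> 'rV[R]_n) a q : dom (AG p) q -> y a = coord (AG p) q ->
  (forall j, smooth (fun x => y x 0 j) a) -> smooth_into (fun x => param (AG p) (y x)) a.
Proof.
move=> pq ya sy.
have ia : (coord (AG p) @` dom (AG p)) (y a) by rewrite ya; exists q.
have cy := differentiable_continuous (smooth_row_differentiable sy).
have [cg ne] := param_curve_near hG ia cy.
have [pg _] := coord_paramK hG ia.
split=> // j.
have s : forall j, smooth (fun x => coord (AG p) (param (AG p) (y x)) 0 j) a.
  by move=> i; apply: smooth_ext (sy i); apply: filterS ne => s /= <-.
exact: (curve_smooth_change hG cg pg (atlas_cover hG _) s).
Qed.

Lemma smooth_into_inv g a : smooth_into g a -> smooth_into (fun x => (g x)^-1%g) a.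
Proof.
move=> [cg sg]; have [ci /(cinfty_row (frame_row n)) si] := lie_inv_smooth (g a).
split; first exact: (continuous_comp cg ci).
move=> j.
have := smooth_row_comp sg (si j); apply: smooth_ext.
have := curve_dom_near hG cg (atlas_cover hG (g a)); apply: filterS => x dx.
by rewrite /local_expr /= (atlas_coordK hG).
Qed.

Lemma smooth_into_mul g1 g2 a : smooth_into g1 a -> smooth_into g2 a ->
  smooth_into (fun x => (g1 x * g2 x)%g) a.
Proof.
move=> [c1 s1] [c2 s2].
have [cm /(cinfty_row frame_rows) sm] := lie_mul_smooth (g1 a, g2 a).
split.
  have c12 : {for a, continuous (fun x => (g1 x, g2 x))} by apply: cvg_pair.
  exact: (continuous_comp c12 cm).
move=> j; have := smooth_pair_comp s1 s2 (sm j).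
apply: smooth_ext.
have d1 := curve_dom_near hG c1 (atlas_cover hG (g1 a)).
have d2 := curve_dom_near hG c2 (atlas_cover hG (g2 a)).
apply: filterS (filterI d1 d2) => x [dx1 dx2].
by rewrite /local_expr /= !(atlas_coordK hG).
Qed.

End LieMaps.

Section MaurerCartan.
Context {R : realType} {n : nat} {G : lie_group R n}.
Local Notation AG := (lie_atlas G).
Local Notation hG := (lie_manifold G).
Local Notation V := 'rV[R]_n.

Let smooth_id (x : V) j : smooth (fun y : V => y 0 j) x.
Proof. exact: (smooth_linear (l := rowcoord j) x (@coord_continuous _ _ _ 0 j)). Qed.

Lemma left_translation_smooth (x p q : G) : dom (AG p) q ->
  smooth_into (fun z => (x * param (AG p) z)%g) (coord (AG p) q).
Proof.
move=> pq; apply: smooth_into_mul; first exact: smooth_into_cst.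
exact: (smooth_into_param pq).
Qed.

Lemma left_translation_differentiable (x p p' q : G) : dom (AG p) q -> dom (AG p') (x * q)%g ->
  differentiable (fun z => coord (AG p') (x * param (AG p) z)%g) (coord (AG p) q).
Proof.
move=> pq p'q; apply: smooth_row_differentiable.
apply: (smooth_into_chart (left_translation_smooth x pq)).
by rewrite (atlas_coordK hG).
Qed.

Lemma maurer_cartanE (x : G) v : maurer_cartan x v =
  'D_v (fun z => coord (AG 1%g) (x^-1 * param (AG x) z)%g) (coord (AG x) x).
Proof. by rewrite /maurer_cartan /tangent_map /local_expr mulVg. Qed.

Let mc_diff (x : G) : differentiable (fun z => coord (AG 1%g) (x^-1 * param (AG x) z)%g)
  (coord (AG x) x).
Proof.
apply: left_translation_differentiable; first exact: (atlas_cover hG).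
by rewrite mulVg; exact: (atlas_cover hG).
Qed.

Lemma maurer_cartan_linear (x : G) : linear (maurer_cartan x).
Proof. by move=> k u v; rewrite !maurer_cartanE !deriveE// linearP. Qed.

(** Left translation by [x] undoes left translation by [x^-1]; differentiating the composite gives a
    left inverse of the form at [x]. *)
Lemma maurer_cartan_inj (x : G) v : maurer_cartan x v = 0 -> v = 0.
Proof.
rewrite maurer_cartanE => v0.
have d1 := mc_diff x.
have cx := atlas_cover hG x; have c1 := atlas_cover hG (1%g : G).
have d2 : differentiable (fun z => coord (AG x) (x * param (AG 1%g) z)%g) (coord (AG 1%g) 1%g).
  by apply: left_translation_differentiable => //; rewrite mulg1.
have E : coord (AG 1%g) 1%g = coord (AG 1%g) (x^-1 * param (AG x) (coord (AG x) x))%g.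
  by rewrite (atlas_coordK hG cx) mulVg.
rewrite E in d2.
have := derive_comp v d1 d2; rewrite v0 derive0 => <-.
rewrite -[LHS](derive_id (coord (AG x) x) v); apply: near_eq_derive.
have [cm _] := left_translation_smooth x^-1%g cx.
have h1 := curve_dom_near hG cm (p := 1%g).
have {}h1 : \forall z \near coord (AG x) x, dom (AG 1%g) (x^-1 * param (AG x) z)%g.
  by apply: h1; rewrite (atlas_coordK hG cx) mulVg.
apply: filterS (filterI h1 (coord_dom_nbhs hG cx)) => z [p'x /(coord_paramK hG)[px xE]] /=.
by rewrite (atlas_coordK hG p'x) mulVKg xE.
Qed.

(** The Maurer-Cartan form at the point with coordinates [z] is the derivative of [Psi p] in its
    second variable on the diagonal. Joint smoothness of [Psi p] thus yields smoothness of the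
    form. *)
Let Psi (p : G) (w : V * V) : V :=
  coord (AG 1%g) ((param (AG p) w.1)^-1 * param (AG p) w.2)%g.

Let Psi_smooth p q : dom (AG p) q -> forall j,
  smooth (fun w => Psi p w 0 j) (coord (AG p) q, coord (AG p) q).
Proof.
move=> pq.
have s : smooth_into (fun w : V * V => ((param (AG p) w.1)^-1 * param (AG p) w.2)%g)
    (coord (AG p) q, coord (AG p) q).
  apply: smooth_into_mul.
    apply: smooth_into_inv; apply: (smooth_into_param pq) => // j.
    exact: smooth_fst_row.
  apply: (smooth_into_param pq) => // j; exact: smooth_snd_row.
apply: (smooth_into_chart s); rewrite /= (atlas_coordK hG pq) mulVg.
exact: (atlas_cover hG).
Qed.

Lemma maurer_cartan_smooth_form : smooth_form AG (@maurer_cartan R n G).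
Proof.
split; first exact: maurer_cartan_linear.
move=> p q pq v; apply/(cinfty_row (frame_row n)) => j.
pose q0 := coord (AG p) q.
have sD : smooth (fun x : V => 'D_((0, v) : V * V) (fun w => Psi p w 0 j) (x, x)) q0.
  exact: (smooth_pair_comp (smooth_id q0) (smooth_id q0)
    (smooth_derive ((0, v) : V * V) (Psi_smooth pq j))).
apply: smooth_ext sD.
apply: filterS (coord_dom_nbhs hG pq) => x [X pX <-] /=.
have dPsi : differentiable (Psi p) (coord (AG p) X, coord (AG p) X).
  exact: (smooth_row_differentiable (Psi_smooth pX)).
rewrite -derive_row// (atlas_coordK hG pX) maurer_cartanE.
apply: (congr1 (fun w : V => w 0 j)).
have XX := atlas_cover hG X.
rewrite /tangent_map /local_expr /= (atlas_coordK hG pX).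
have tE : (coord (AG X) \o param (AG p)) (coord (AG p) X) = coord (AG X) X.
  by rewrite /= (atlas_coordK hG pX).
have dt := transition_differentiable hG pX XX.
rewrite -tE -derive_comp//; last by rewrite tE; exact: mc_diff.
(* Differentiation along [(0, v)] freezes the first variable; what remains is the change between the
   charts at [p] and at [X]. *)
transitivity ('D_v (fun z : V => Psi p (coord (AG p) X, z)) (coord (AG p) X)).
  rewrite /derive; set f1 := fun h => h^-1 *: _; set f2 := fun h => h^-1 *: _.
  suff -> : f1 = f2 by [].
  apply/funext => h; rewrite /f1 /f2 /=; congr (_ *: (Psi _ _ - _)).
  by apply: injective_projections; rewrite /= ?scaler0 ?add0r.
have cp : {for coord (AG p) X, continuous (param (AG p))}.
  exact: (atlas_param_continuous hG).
have h1 : \forall z \near coord (AG p) X, dom (AG X) (param (AG p) z).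
  by apply: cp; rewrite (atlas_coordK hG pX); exact: (dom_nbhs hG).
apply: (near_eq_derive (f := fun z : V => Psi p (coord (AG p) X, z))).
apply: filterS h1 => z dz /=.
by rewrite /Psi /= (atlas_coordK hG pX) (atlas_coordK hG dz).
Qed.

End MaurerCartan.

(** * Existence of antidevelopments *)

Section InnerProduct.
Context {R : realType} {n : nat} (ip : {dot 'rV[R]_n for idfun}).
Implicit Types v : 'rV[R]_n.

Lemma dot_quadratic v :
  ip v v = \sum_i \sum_j v 0 i * (v 0 j * ip (delta_mx 0 i) (delta_mx 0 j)).
Proof.
rewrite {1}(row_sum_delta v) linear_sumlz; apply: eq_bigr => i _.
rewrite linearZl_LR /= [X in _ * ip _ X](row_sum_delta v) linear_sumr mulr_sumr.
by apply: eq_bigr => j _; rewrite linearZr_LR.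
Qed.

Lemma dotZ (a : R) v : ip (a *: v) (a *: v) = a ^+ 2 * ip v v.
Proof. by rewrite linearZl_LR linearZr_LR /= mulrA. Qed.

Lemma dot_continuous : continuous (fun v => ip v v).
Proof.
rewrite (_ : (fun v => ip v v) = fun v => \sum_i \sum_j v 0 i *
    (v 0 j * ip (delta_mx 0 i) (delta_mx 0 j))); last first.
  by apply/funext => v; exact: dot_quadratic.
move=> v; apply: continuous_for_sum => i; apply: continuous_for_sum => j.
apply: continuousM; first exact: coord_continuous.
apply: continuousM; first exact: coord_continuous.
exact: cst_continuous.
Qed.

Lemma dot_norm_continuous : continuous (fun v => Num.sqrt (ip v v)).
Proof. by move=> v; apply: continuous_comp; [exact: dot_continuous|exact: sqrt_continuous]. Qed.

(** [K] is the inverse of the minimum of the inner-product norm over the unit sphere, which is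
    compact; homogeneity does the rest. *)
Lemma norm_le_dot : exists2 K, 0 < K & forall v, `|v| <= K * Num.sqrt (ip v v).
Proof.
(* In dimension 0 the sphere is empty and there is nothing to minimise. *)
have [[w w0]|h] := pselect (exists v : 'rV[R]_n, v != 0); last first.
  exists 1 => // v; have -> : v = 0.
    by apply/eqP; apply: contrapT => v0; apply: h; exists v; apply/negP.
  by rewrite normr0 mul1r sqrtr_ge0.
pose S := [set v : 'rV[R]_n | `|v| = 1].
have unitS v : v != 0 -> S (`|v|^-1 *: v).
  by move=> v0; rewrite /S /= normrZ normfV normr_id mulVf// normr_eq0.
have Sc : compact S.
  apply: bounded_closed_compact.
    by exists 1; split=> [|x x1 v /= ->]; [exact: num_real|exact: ltW].
  have -> : S = (fun v : 'rV[R]_n => `|v|) @^-1` [set 1] by [].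
  apply: preimage_closed => [v _|]; [exact: norm_continuous|exact: closed_eq].
have [||u uS umin] := @EVT_min_rV R n (fun v => Num.sqrt (ip v v)) S _ Sc.
- by exists (`|w|^-1 *: w); exact: unitS.
- by apply: continuous_subspaceT => v; exact: dot_norm_continuous.
have u0 : u != 0.
  by apply/eqP => u0; move: uS; rewrite inE /S /= u0 normr0 => /eqP; rewrite eq_sym oner_eq0.
have m0 : 0 < Num.sqrt (ip u u) by rewrite sqrtr_gt0 neq0_dnorm_gt0.
exists (Num.sqrt (ip u u))^-1; first by rewrite invr_gt0.
move=> v; have [->|v0] := eqVneq v 0.
  by rewrite normr0 mulr_ge0 ?sqrtr_ge0// invr_ge0 sqrtr_ge0.
rewrite mulrC ler_pdivlMr//.
have := umin (`|v|^-1 *: v); rewrite inE => /(_ (unitS v v0)).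
rewrite dotZ sqrtrM ?sqr_ge0// sqrtr_sqr ger0_norm ?invr_ge0//.
by rewrite ler_pdivlMl ?normr_gt0.
Qed.

End InnerProduct.

Section OffFinite.
Context {R : realType}.
Notation mu := (@lebesgue_measure R).

(** Every subset of a finite set is measurable, so the values of [f] at the exceptional points
    cannot spoil measurability. *)
Lemma measurable_off_finite (f : R -> R) (s : seq R) :
  (forall t, 0 < t < 1 -> t \notin s -> {for t, continuous f}) ->
  measurable_fun (`[0, 1] : set R) f.
Proof.
move=> cf; pose F : set R := [set` [:: 0, 1 & s]].
have cF (X : set R) : X `<=` F -> measurable X.
  move=> XF; apply: countable_measurable; first exact: measurable_set1.
  by apply: finite_set_countable; exact: sub_finite_set XF (finite_seq _).
have -> : (`[0, 1]%classic : set R) = (`[0, 1] `\` F) `|` (`[0, 1] `&` F).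
  by rewrite setUC setUIDK.
have mF : measurable F by exact: cF.
have m1 : measurable ((`[0, 1] : set R) `\` F) by exact: measurableD.
apply/measurable_funU => //; first exact: measurableI.
split; last first.
  by move=> _ B _; apply: cF => x [[]].
apply: subspace_continuous_measurable_fun => //.
apply: continuous_in_subspaceT => t; rewrite inE /= => -[].
rewrite in_itv /= => /andP[t0 t1] tF; apply: cf; last first.
  by apply/negP => ts; apply: tF; rewrite /F /= !inE ts !orbT.
by rewrite !lt_neqAle t0 t1 !andbT; apply/andP; split; apply/eqP => tE; apply: tF;
  rewrite /F /= !inE tE eqxx ?orbT.
Qed.

End OffFinite.

Section PartitionPieces.
Context {R : realType}.

Lemma path_lt_last (a : R) (s : seq R) : path <%R a s -> a <= last a s.
Proof.
by elim: s a => //= x s IH a /andP[/ltW ax /IH]; exact: le_trans.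
Qed.

Lemma partition_nth (a : R) (s : seq R) i : path <%R a s -> (i < size s)%N ->
  [/\ a <= nth 0 (a :: s) i, nth 0 (a :: s) i < nth 0 (a :: s) i.+1 &
      nth 0 (a :: s) i.+1 <= last a s].
Proof.
elim: s a i => // x s IH a [|i] /= /andP[ax xs] si.
  by rewrite lexx ax path_lt_last.
by have [h1 h2 h3] := IH x i xs si; split=> //; exact: le_trans (ltW ax) h1.
Qed.

(* The germs z need to match xi only on the open piece: at a partition point the
   velocity of a piecewise smooth path is junk. *)
Definition piecewise_germs {n : nat} (s : seq R) (xi : R -> 'rV[R]_n) : Prop :=
  forall i, (i < size s)%N ->
  forall t, t \in `[nth 0 (0 :: s) i, nth 0 (0 :: s) i.+1] ->
  exists2 z : R -> 'rV[R]_n, forall j, smooth (fun q => z q 0 j) t &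
    \forall q \near t, q \in `]nth 0 (0 :: s) i, nth 0 (0 :: s) i.+1[ -> z q = xi q.

Lemma piecewise_germs_continuous {n : nat} (s : seq R) (xi : R -> 'rV[R]_n) t :
  itv_partition 0 1 s -> piecewise_germs s xi -> 0 < t < 1 -> t \notin s ->
  {for t, continuous xi}.
Proof.
move=> [ps /eqP ls] hs /andP[t0 t1] ts.
have [i si /andP[it ti]] := path_find_right ps (ltW t0) (eq_ind_r (fun x => t < x) t1 ls).
have it' : nth 0 (0 :: s) i < t.
  rewrite lt_neqAle it andbT; case: i si {it ti} => [|i] si /=; first by rewrite lt_eqF.
  by apply/eqP => E; move: ts; rewrite -E mem_nth// ltnW.
have tI : t \in `]nth 0 (0 :: s) i, nth 0 (0 :: s) i.+1[ by rewrite in_itv /= it'.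
have [z sz zx] := hs i si t (subset_itv_oo_cc tI).
have cz := differentiable_continuous (smooth_row_differentiable sz).
apply: near_eq_continuous cz; apply: filterS (filterI zx (near_in_itvoo tI)).
by move=> q [h /h].
Qed.

End PartitionPieces.

Section Antidevelopment.
Context {R : realType} {n : nat} {T : topologicalType} {A : atlas 'rV[R]_n T}.
Notation mu := (@lebesgue_measure R).
Variable omega : T -> 'rV[R]_n -> 'rV[R]_n.
Hypothesis hA : is_manifold A.
Hypothesis hom : smooth_form A omega.
Hypothesis omega_inj : forall p v, omega p v = 0 -> v = 0.

(* z need not agree with xi outside the piece, so y is compared with x only on
   the intersection of the piece with a small interval around t. *)
Lemma chart_solution_germ (W : 'rV[R]_n -> 'M[R]_n) (x xi z : R -> 'rV[R]_n) (u v t : R) :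
  t \in `[u, v] -> {within `[u, v], continuous x} ->
  (forall i j, smooth (fun y => W y i j) (x t)) ->
  (forall q, q \in `]u, v[ -> {for q, continuous xi} -> is_derive q 1 x (xi q *m W (x q))) ->
  (forall j, smooth (fun q => z q 0 j) t) ->
  (\forall q \near t, q \in `]u, v[ -> z q = xi q) ->
  exists y : R -> 'rV[R]_n, [/\ y t = x t, forall j, smooth (fun q => y q 0 j) t &
    \forall q \near t, q \in `[u, v] -> y q = x q].
Proof.
move=> tuv cx sW dx sz zxi.
have [y [yt sy dy]] := chart_ode_smooth sW sz.
exists y; split=> //.
have [C C0 hC] := smooth_mx_local_bounds sW.
have [rho [hrho rho0]] : exists rho, (forall y z,
    `|y - x t| <= rho -> `|z - x t| <= rho ->
    (forall v : 'rV[R]_n, `|v *m W y| <= C * `|v|) /\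
    forall v : 'rV[R]_n, `|v *m W y - v *m W z| <= C * `|v| * `|y - z|) /\ 0 < rho.
  have h2 : \forall rho \near (0:R)^'+, 0 < rho by exact: nbhs_right_gt.
  by have [rho [h h']] := filter_ex (filterI hC h2); exists rho.
pose M := `|z t| + 1.
have cz := differentiable_continuous (smooth_row_differentiable sz).
have h1 : \forall q \near t, `|z q| <= M.
  have : \forall q \near t, `|z t - z q| <= 1 by move/cvgrPdist_le : cz; apply.
  apply: filterS => q h; rewrite /M -[z q](subrK (z t)) (le_trans (ler_normD _ _))//.
  by rewrite addrC lerD2l distrC.
have h2 : \forall q \near t, {for q, continuous z}.
  apply: filterS (smooth_row_near sz) => q szq.
  exact: differentiable_continuous (smooth_row_differentiable szq).
have h3 : \forall q \near t, {for q, continuous y} /\ `|y q - x t| <= rho.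
  have cy : {for t, continuous y} := differentiable_continuous (smooth_row_differentiable sy).
  have : \forall q \near t, `|y t - y q| <= rho by move/cvgrPdist_le : cy; apply.
  move=> h; apply: filterS (filterI h (smooth_row_near sy)) => q [yq syq]; split.
    exact: differentiable_continuous (smooth_row_differentiable syq).
  by rewrite distrC; move: yq; rewrite yt.
have h4 : \forall q \near t, q \in `[u, v] -> `|x q - x t| <= rho.
  move/subspace_continuousP : (cx) => /(_ t tuv) /cvgrPdist_lt /(_ _ rho0) h.
  have {}h : \forall q \near t, q \in `[u, v] -> `|x t - x q| < rho by exact: h.
  by apply: filterS h => q hq /hq /ltW; rewrite distrC.
(* Agreement of [z] and [xi] near each nearby point of the open piece makes [xi] continuous there,
   and this is what [dx] asks for. *)
have h5 := near_join zxi.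
have /nbhs_ballP[d /= d0 hd] : \forall q \near t, [/\ is_derive q (1 : R) y (z q *m W (y q)),
    `|z q| <= M, {for q, continuous z}, {for q, continuous y} /\ `|y q - x t| <= rho &
    (q \in `[u, v] -> `|x q - x t| <= rho) /\
    \forall r \near q, r \in `]u, v[ -> z r = xi r].
  near=> q; split; [exact: (near dy q)|exact: (near h1 q)|exact: (near h2 q)|
    exact: (near h3 q)|split; [exact: (near h4 q)|exact: (near h5 q)]].
have M0 : 0 <= M by rewrite addr_ge0.
have K0 : 0 < C * M + 1 by rewrite ltr_wpDl// mulr_ge0.
have k1 : \forall r \near (0:R)^'+, 0 < r by exact: nbhs_right_gt.
have k2 : \forall r \near (0:R)^'+, r < d by exact: nbhs_right_lt.
(* The interval [[a, b]] may extend by [r] to both sides of [t], hence the factor 2. *)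
have k3 : \forall r \near (0:R)^'+, r < (C * M + 1)^-1 / 2.
  by apply: nbhs_right_lt; rewrite divr_gt0// invr_gt0.
have [r [r0 [rd rC]]] := filter_ex (filterI k1 (filterI k2 k3)).
pose a := Num.max u (t - r); pose b := Num.min v (t + r).
have [/andP[ut tv]] : u <= t <= v /\ true by move: tuv; rewrite in_itv.
move=> _.
have abE q : (q \in `[a, b]) = (q \in `[u, v]) && (q \in `[t - r, t + r]).
  by rewrite !in_itv /= /a /b ge_max le_min; do 4 case: (_ <= _).
have abo q : q \in `]a, b[ -> q \in `]u, v[.
  by rewrite !in_itv /= /a /b gt_max lt_min => /andP[/andP[-> _] /andP[-> _]].
have inb q : q \in `[t - r, t + r] -> ball t d q.
  rewrite in_itv /= => /andP[tq qt]; rewrite /ball /= (le_lt_trans _ rd)//.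
  by rewrite distrC ler_distl tq.
have tr : t \in `[t - r, t + r] by rewrite in_itv /= lerBlDr !lerDl ltW.
have tab : t \in `[a, b] by rewrite abE tuv.
have nr : \forall q \near t, q \in `[t - r, t + r].
  have : t \in `]t - r, t + r[ by rewrite in_itv /= ltrBlDr !ltrDl r0.
  by move=> /near_in_itvoo; apply: filterS => q; exact: subset_itv_oo_cc.
suff xy : forall q, q \in `[a, b] -> y q = x q.
  by apply: filterS nr => q qr quv; apply: xy; rewrite abE quv.
have sub : `[a, b] `<=` `[u, v].
  by move=> q /=; rewrite abE => /andP[].
apply: (@ode_unique R n W y x z (x t) rho C M a b t C0 M0).
- by move=> p q px qx; exact: (hrho p q px qx).2.
- exact: tab.
- apply: (@le_lt_trans _ _ ((C * M + 1) * (2 * r))).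
    apply: ler_pM => //; [exact: mulr_ge0| | |].
    + by rewrite subr_ge0; move: tab; rewrite in_itv /= => /andP[]; exact: le_trans.
    + by rewrite lerDl.
    rewrite /a /b; have -> : 2 * r = (t + r) - (t - r) by ring.
    by rewrite lerB// ?ge_min ?le_max lexx orbT.
  by rewrite [2 * r]mulrC -ltr_pdivlMl// mulr1 -ltr_pdivlMr.
- apply: continuous_in_subspaceT => q; rewrite inE /= abE => /andP[_ /inb /hd].
  by case=> _ _ _ [].
- exact: continuous_subspaceW cx.
- exact: yt.
- move=> q qab; have := subset_itv_oo_cc qab; rewrite abE => /andP[quv /inb /hd].
  by move=> [_ _ _ [_ yq] [xq _]]; split=> //; exact: xq.
move=> q qab; have := subset_itv_oo_cc qab; rewrite abE => /andP[quv /inb /hd].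
move=> [dyq zM czq _ [_ zxq]]; split=> //.
have quvo := abo q qab.
rewrite (nbhs_singleton zxq quvo); apply: dx => //.
apply: near_eq_continuous czq; apply: filterS (filterI zxq (near_in_itvoo quvo)).
by move=> p [h /h].
Unshelve. all: by end_near. Qed.

Theorem antidevelopment_exists (e : T) : exists2 r : R, 0 < r &
  forall (xi : R -> 'rV[R]_n) (s : seq R), itv_partition 0 1 s -> piecewise_germs s xi ->
  (\int[mu]_(t in `[0%R, 1%R]) (`|xi t|)%:E < r%:E)%E ->
  exists gamma : R -> T, [/\ gamma 0 = e,
    forall i, (i < size s)%N -> smooth_on (@id_atlas R) A
      [set` `[nth 0 (0 :: s) i, nth 0 (0 :: s) i.+1]] gamma &
    forall t, t \in `]0, 1[ -> {for t, continuous xi} ->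
      smooth_at (@id_atlas R) A gamma t ->
      omega (gamma t) (velocity A gamma t) = xi t].
Proof.
have ee := atlas_cover hA e.
pose x0 := coord (A e) e; pose W := frame_mx (A := A) omega e.
have sW : forall i j, smooth (fun y => W y i j) x0 by exact: frame_mx_smooth.
have [C C0 hC] := smooth_mx_local_bounds sW.
have /nbhs_normP[d /= d0 hd] := coord_dom_nbhs hA ee.
have [rho [hrho rho0 rhod]] : exists rho, [/\ (forall y z,
    `|y - x0| <= rho -> `|z - x0| <= rho ->
    (forall v : 'rV[R]_n, `|v *m W y| <= C * `|v|) /\
    forall v : 'rV[R]_n, `|v *m W y - v *m W z| <= C * `|v| * `|y - z|),
    0 < rho & rho < d].
  have h2 : \forall rho \near (0:R)^'+, 0 < rho by exact: nbhs_right_gt.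
  have h3 : \forall rho \near (0:R)^'+, rho < d by exact: nbhs_right_lt.
  have [rho [[h h'] h'']] := filter_ex (filterI (filterI hC h2) h3).
  by exists rho.
have inim y : `|y - x0| <= rho -> (coord (A e) @` dom (A e)) y.
  by move=> yx; apply: hd; rewrite /ball_ /= distrC (le_lt_trans yx).
have sWb y : `|y - x0| <= rho -> forall i j, smooth (fun y => W y i j) y.
  by move=> /inim[q eq <-]; exact: frame_mx_smooth.
have m0 : 0 < Num.min rho 1 by rewrite lt_min rho0 ltr01.
have K0 : 0 < C + 1 by rewrite ltr_wpDl.
(* An integral of [|xi|] below this value makes [C] times it less than [rho], so the Picard operator
   preserves the ball, and less than 1, so it contracts. Nothing here depends on [xi] or on the
   partition. *)
exists (Num.min rho 1 / (C + 1)); first by rewrite divr_gt0.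
move=> xi s ps hs Ixi.
have cxi := piecewise_germs_continuous ps hs.
have mxi j : measurable_fun (`[0, 1] : set R) (fun t => xi t 0 j).
  apply: (measurable_off_finite (s := s)) => t t01 ts.
  exact: (continuous_comp (cxi t t01 ts) (@coord_continuous _ _ _ 0 j _)).
have mn : measurable_fun (`[0, 1] : set R) (fun t => `|xi t|).
  apply: (measurable_off_finite (s := s)) => t t01 ts.
  exact: (continuous_comp (cxi t t01 ts) (@norm_continuous _ _ _)).
have ie : mu.-integrable `[0, 1] (EFin \o (fun t => `|xi t|)).
  apply/integrableP; split; first exact/measurable_EFinP.
  under eq_integral do rewrite /= normr_id.
  by rewrite (lt_trans Ixi)// ltry.
have I0 : \int[mu]_(t in `[0, 1]) `|xi t| < Num.min rho 1 / (C + 1).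
  rewrite -lte_fin /Rintegral fineK//; exact: integrable_fin_num ie.
have CI : C * (\int[mu]_(t in `[0, 1]) `|xi t|) < Num.min rho 1.
  apply: (@le_lt_trans _ _ ((C + 1) * (\int[mu]_(t in `[0, 1]) `|xi t|))).
    by rewrite ler_wpM2r ?lerDl//; exact: Rintegral_ge0.
  by rewrite mulrC -ltr_pdivlMr.
have t00 : (0 : R) \in `[0, 1] by rewrite in_itv /= lexx ler01.
have [|||x [cx xx0 bx dx]] := @chart_ode_exists R n W x0 rho C xi 0 1 0 (ltW rho0) C0 ltr01 t00
  hrho _ mxi ie.
- by move=> y yx i j; apply: smooth_continuous; exact: sWb.
- by move: CI; rewrite lt_min => /andP[/ltW].
- by move: CI; rewrite lt_min => /andP[].
have im t : t \in `[0, 1] -> (coord (A e) @` dom (A e)) (x t) by move=> /bx /inim.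
exists (fun t => param (A e) (x t)); split.
- by rewrite xx0 /x0 (atlas_coordK hA ee).
- move=> i si t; rewrite /= => tI.
  have [ps' /eqP ls] := ps; have [u0 uv v1] := partition_nth ps' si; rewrite ls in v1.
  have sub01 : `[nth 0 (0 :: s) i, nth 0 (0 :: s) i.+1] `<=` `[0, 1].
    by apply: subset_itv; rewrite bnd_simp.
  have [z sz zx] := hs i si t tI.
  have cx' : {within `[nth 0 (0 :: s) i, nth 0 (0 :: s) i.+1], continuous x}.
    exact: continuous_subspaceW cx.
  have t01 := sub01 t tI.
  have dx' q : q \in `]nth 0 (0 :: s) i, nth 0 (0 :: s) i.+1[ ->
      {for q, continuous xi} -> is_derive q 1 x (xi q *m W (x q)).
    move=> qI; apply: dx; move: qI; rewrite !in_itv /= => /andP[h1 h2].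
    by rewrite (le_lt_trans u0) ?(lt_le_trans h2).
  (* [smooth_on] asks for a curve smooth at [t] itself, possibly an endpoint of the piece; [y]
     provides it in coordinates. *)
  have [y [yt sy yx]] := chart_solution_germ tI cx' (sWb _ (bx t t01)) dx' sz zx.
  exists (fun q => param (A e) (y q)).
    by apply: (param_curve_smooth hA) => //; rewrite yt; exact: im.
  by apply: filterS yx => q h /h ->.
move=> t tI cxt sm; have t01 := subset_itv_oo_cc tI.
have [pg xt] := coord_paramK hA (im t t01).
have xE : {near t, (fun q => coord (A e) (param (A e) (x q))) =1 x}.
  apply: filterS (near_in_itvoo tI) => q qI.
  by have [] := coord_paramK hA (im q (subset_itv_oo_cc qI)).
rewrite (form_velocity hA hom sm.1 pg ((curve_smoothP hA sm.1 pg).1 sm)) /=.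
rewrite (near_eq_derive _ xE) xt.
have [_ ->] := dx t tI cxt.
rewrite /W /frame_mx mulmxKV//; have [q eq <-] := im t t01.
exact: form_mx_unit.
Qed.

End Antidevelopment.

Lemma linear_injective_leq {K : fieldType} (m n : nat) (f : 'rV[K]_m -> 'rV[K]_n) :
  linear f -> injective f -> (m <= n)%N.
Proof.
move=> lf inj_f; pose fM := GRing.isLinear.Build _ _ _ _ _ lf.
pose fL : {linear 'rV[K]_m -> 'rV[K]_n} := HB.pack f fM.
have /eqP <- : row_free (lin1_mx fL); last exact: rank_leq_col.
apply: inj_row_free => v; rewrite mul_rV_lin1 => fv0; apply: inj_f.
by rewrite -[LHS]/(fL v) fv0 -[RHS]/(fL 0) linear0.
Qed.

Lemma linear_bijective_dim {K : fieldType} (m n : nat) (f : 'rV[K]_m -> 'rV[K]_n) :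
  linear f -> bijective f -> m = n.
Proof.
move=> lf [h fK hK]; apply/eqP; rewrite eqn_leq.
rewrite (linear_injective_leq lf (can_inj fK)) /=.
apply: (@linear_injective_leq _ _ _ h); last exact: can_inj hK.
by move=> a u v; apply: (can_inj fK); rewrite lf !hK.
Qed.

(* The dimension of the total space of a Cartan geometry of type (G, H) equals
   dim G only propositionally. *)
Section EqualDimensions.
Context {R : realType} {m n : nat} {T : topologicalType} {A : atlas 'rV[R]_m T}.
Variable omega : T -> 'rV[R]_m -> 'rV[R]_n.
Hypothesis mn : m = n.
Hypothesis hA : is_manifold A.
Hypothesis hom : smooth_form A omega.
Hypothesis omega_inj : forall p v, omega p v = 0 -> v = 0.

Lemma paths_unique_eqdim (c1 c2 : R -> T) :
  piecewise_smooth_path A c1 -> piecewise_smooth_path A c2 -> c1 0 = c2 0 ->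
  (forall t : R, 0 <= t < 1 -> \forall s \near t^'+,
     omega (c1 s) (velocity A c1 s) = omega (c2 s) (velocity A c2 s)) ->
  {in `[0, 1], c1 =1 c2}.
Proof. by subst n; exact: paths_unique. Qed.

Lemma antidevelopment_exists_eqdim (e : T) : exists2 r : R, 0 < r &
  forall (xi : R -> 'rV[R]_n) (s : seq R), itv_partition 0 1 s -> piecewise_germs s xi ->
  (\int[@lebesgue_measure R]_(t in `[0%R, 1%R]) (`|xi t|)%:E < r%:E)%E ->
  exists gamma : R -> T, [/\ gamma 0 = e,
    forall i, (i < size s)%N -> smooth_on (@id_atlas R) A
      [set` `[nth 0 (0 :: s) i, nth 0 (0 :: s) i.+1]] gamma &
    forall t, t \in `]0, 1[ -> {for t, continuous xi} ->
      smooth_at (@id_atlas R) A gamma t ->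
      omega (gamma t) (velocity A gamma t) = xi t].
Proof. by subst n; exact: antidevelopment_exists. Qed.

End EqualDimensions.

(** * Application to Cartan geometries *)

Section CartanDevelopment.
Context {R : realType} {n k : nat} {G : lie_group R n} {H : model G} {M : manifold R k}.
Variables (C : cartan_geometry H M) (ip : {dot 'rV[R]_n for idfun}).
Local Notation AG := (lie_atlas G).
Local Notation AC := (mfd_atlas C).
Local Notation hG := (lie_manifold G).
Local Notation hC := (mfd_axioms C).
Local Notation mu := (@lebesgue_measure R).

(** The left Darboux, or logarithmic, derivative of [c]; it is the driving term [xi] of the
    antidevelopment equation. *)
Definition darboux (c : R -> G) (t : R) : 'rV[R]_n :=
  maurer_cartan (c t) (velocity AG c t).

Lemma darboux_continuous (c : R -> G) t : smooth_at (@id_atlas R) AG c t ->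
  {for t, continuous (darboux c)}.
Proof.
move=> sm; apply: differentiable_continuous; apply: smooth_row_differentiable.
exact: (form_along_smooth hG (maurer_cartan_smooth_form (G := G)) sm).
Qed.

Lemma darboux_germs (c : R -> G) (s : seq R) :
  (forall i, (i < size s)%N -> smooth_on (@id_atlas R) AG
     [set` `[nth 0 (0 :: s) i, nth 0 (0 :: s) i.+1]] c) ->
  piecewise_germs s (darboux c).
Proof.
move=> sm i si t tI; have [z sz zc] := sm i si t tI.
exists (darboux z).
  exact: (form_along_smooth hG (maurer_cartan_smooth_form (G := G)) sz).
apply: filterS (near_join zc) => q zq qI.
have zcq : {near q, z =1 c}.
  apply: filterS (filterI zq (near_in_itvoo qI)) => r [h rI].
  exact/h/subset_itv_oo_cc.
by rewrite /darboux (velocity_ext zcq) (nbhs_singleton zcq).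
Qed.

(** Both integrands are norms of the same vector [darboux c t], so they compare pointwise, even at
    partition points. The partition serves only for measurability. *)
Lemma length_bound : exists2 K, 0 < K & forall c : R -> G, piecewise_smooth_path AG c ->
  (\int[mu]_(t in `[0%R, 1%R]) (`|darboux c t|)%:E <= K%:E * path_length ip c)%E.
Proof.
have [K K0 hK] := norm_le_dot ip.
exists K => // c [s ps sm].
have cd := piecewise_germs_continuous ps (darboux_germs sm).
have m1 : measurable_fun (`[0, 1] : set R) (fun t => `|darboux c t|).
  apply: (measurable_off_finite (s := s)) => t t01 ts.
  exact: (continuous_comp (cd t t01 ts) (@norm_continuous _ _ _)).
have m2 : measurable_fun (`[0, 1] : set R)
    (fun t => Num.sqrt (ip (darboux c t) (darboux c t))).
  apply: (measurable_off_finite (s := s)) => t t01 ts.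
  exact: (@continuous_comp _ _ _ (darboux c) (fun v => Num.sqrt (ip v v)) t
    (cd t t01 ts) (@dot_norm_continuous _ _ ip (darboux c t))).
have m2e : measurable_fun (`[0, 1] : set R)
    (fun t => (Num.sqrt (ip (darboux c t) (darboux c t)))%:E) by exact/measurable_EFinP.
rewrite /path_length /left_invariant_metric -ge0_integralZl_EFin//; last exact: ltW.
apply: ge0_le_integral => //.
- exact/measurable_EFinP.
- exact: measurable_funeM.
by move=> t _; rewrite -EFinM lee_fin; exact: hK.
Qed.

Lemma total_dimE (e : C) : total_dim C = n.
Proof. exact: (linear_bijective_dim ((omega_smooth C).1 e) (omega_iso e)). Qed.

Lemma omega_inj (p : C) v : omega p v = 0 -> v = 0.
Proof.
move=> h; apply: (bij_inj (omega_iso p)); rewrite h.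
pose oM := GRing.isLinear.Build _ _ _ _ _ ((omega_smooth C).1 p).
pose oL : {linear 'rV[R]_(total_dim C) -> 'rV[R]_n} := HB.pack (@omega _ _ _ _ _ _ C p) oM.
by rewrite -[RHS]/(oL 0) linear0.
Qed.

Lemma near_right_inside (t : R) : 0 <= t < 1 -> \forall s \near t^'+, s \in `]0, 1[.
Proof.
move=> /andP[t0 t1].
have h1 : \forall s \near t^'+, t < s by exact: nbhs_right_gt.
have h2 : \forall s \near t^'+, s < 1 by exact: nbhs_right_lt.
apply: filterS (filterI h1 h2) => s [ts s1].
by rewrite in_itv /= s1 (le_lt_trans t0).
Qed.

(** Just to the right of each time [gamma], [c] and [c'] are all smooth, and there both
    Maurer-Cartan velocities equal the [omega]-velocity of [gamma]. *)
Lemma development_unique (gamma : R -> C) (c c' : R -> G) :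
  piecewise_smooth_path AC gamma ->
  path_from AG 1%g c -> same_pullback gamma c ->
  path_from AG 1%g c' -> same_pullback gamma c' -> {in `[0, 1], c' =1 c}.
Proof.
move=> pg [pc c0] sc [pc' c0'] sc'.
apply: (paths_unique hG (maurer_cartan_smooth_form (G := G)) (@maurer_cartan_inj R n G)) => //.
  by rewrite c0 c0'.
move=> t t01.
have h1 := piecewise_right_smooth hC pg t01.
have h2 := piecewise_right_smooth hG pc t01.
have h3 := piecewise_right_smooth hG pc' t01.
apply: filterS (filterI (filterI h1 h2) (filterI h3 (near_right_inside t01))).
by move=> s [[s1 s2] [s3 sI]]; rewrite -sc// -sc'.
Qed.

Lemma antidevelopment_unique (c : R -> G) (g1 g2 : R -> C) e :
  piecewise_smooth_path AG c ->
  path_from AC e g1 -> same_pullback g1 c ->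
  path_from AC e g2 -> same_pullback g2 c -> {in `[0, 1], g1 =1 g2}.
Proof.
move=> pc [p1 g10] s1 [p2 g20] s2.
apply: (paths_unique_eqdim (total_dimE e) hC (omega_smooth C) omega_inj) => //.
  by rewrite g10 g20.
move=> t t01.
have h1 := piecewise_right_smooth hC p1 t01.
have h2 := piecewise_right_smooth hC p2 t01.
have h3 := piecewise_right_smooth hG pc t01.
apply: filterS (filterI (filterI h1 h2) (filterI h3 (near_right_inside t01))).
by move=> s [[z1 z2] [z3 sI]]; rewrite s1// s2.
Qed.

End CartanDevelopment.

Theorem lemma3p6 (R : realType) (n k : nat) (G : lie_group R n) (H : model G)
    (M : manifold R k) (C : cartan_geometry H M) (g : {dot 'rV[R]_n for idfun})
    (e : C) :
  exists r : R, 0 < r /\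
    forall c : R -> G, path_from (lie_atlas G) 1%g c ->
      (path_length g c < r%:E)%E ->
      exists gamma : R -> C,
        is_antidevelopment e c gamma /\
        forall gamma', is_antidevelopment e c gamma' ->
          {in `[0, 1], gamma' =1 gamma}.
Proof.
have [r r0 hr] := antidevelopment_exists_eqdim (total_dimE e) (mfd_axioms C)
  (omega_smooth C) (@omega_inj _ _ _ _ _ _ C) e.
have [K K0 hK] := length_bound g (G := G).
(* A length below [r / K] forces the integral of [|darboux c|] below [r]. *)
exists (r / K); split=> [|c pc lc]; first exact: divr_gt0.
have [[s ps sm] c0] := pc.
have [|gamma [gamma0 sg vg]] := hr (darboux c) s ps (darboux_germs sm).
  apply: le_lt_trans (hK c pc.1) _.
  by rewrite -lte_pdivlMl// -EFinM mulrC.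
have pg : path_from (mfd_atlas C) e gamma by split=> //; exists s.
have sp : same_pullback gamma c.
  by move=> t tI smg smc; rewrite (vg t tI (darboux_continuous smc) smg).
exists gamma; split.
  (* The remaining clause of [is_development] asks that every development of [gamma] agree with [c]
     on the unit interval. *)
  split=> //; split=> [//|c' [pc' sc']].
  exact: (development_unique pg.1 pc sp pc' sc').
move=> gamma' [pg' [[_ sp'] _]].
exact: (antidevelopment_unique pc.1 pg' sp' pg sp).
Qed.
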